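(* Let $n$ be an integer with $1\le n\le 5$ and let $\xi$ be any transcendental real number. Then $$\widehat{w}_n(\xi)-\widehat{w}_n^{\ast}(\xi)\le n-1.$$
   Context: Let $n\ge 1$ be an integer and $\xi$ a transcendental real number. The height $H_P$ of a polynomial $P$ is the maximum modulus of its coefficients. The height $H(\alpha)$ of an algebraic number $\alpha$ is the height of its minimal polynomial over the integers with coprime coefficients. For a real parameter $X>1$, let $P_X$ be the non-zero integer polynomial of degree at most $n$ and height at most $X$ that minimizes $|P(\xi)|$ among all such polynomials $P$ (unique up to sign). Let $\alpha_X$ be the algebraic number of degree at most $n$ and height at most $X$ that minimizes $H(\alpha)\cdot|\xi-\alpha|$ among all such $\alpha$. Define $$w(n,\xi,X)=-\frac{\log|P_X(\xi)|}{\log X},\qquad w^{\ast}(n,\xi,X)=-\frac{\log\left(H(\alpha_X)\cdot|\alpha_X-\xi|\right)}{\log X},$$ and $$\widehat{w}_n(\xi)=\liminf_{X\to\infty}w(n,\xi,X),\qquad \widehat{w}_n^{\ast}(\xi)=\liminf_{X\to\infty}w^{\ast}(n,\xi,X).$$ *)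

(* Defs.v *)
From HB Require Import structures.
From mathcomp Require Import all_boot all_order all_algebra.
From mathcomp Require Import all_classical all_reals all_analysis.
From mathcomp Require Import complex.
Set Implicit Arguments.
Unset Strict Implicit.
Unset Printing Implicit Defensive.
Import Order.TTheory GRing.Theory Num.Theory.
Import numFieldNormedType.Exports.
Local Open Scope classical_set_scope.
Local Open Scope ring_scope.

Definition transcendental (R : realType) (xi : R) : Prop :=
  ~ algebraicOver (@ratr R) xi.

Definition poly_height (P : {poly int}) : nat :=
  (\max_(i < size P) absz (P`_i)%R)%N.

(* [zcontents P = 1] says that the coefficients are coprime and that the
   leading one is positive, which fixes the sign. *)
Definition is_minpolyZ (R : realType) (alpha : R[i]) (P : {poly int}) : Prop :=
  [/\ P != 0, root (map_poly intr P) alpha, zcontents P = 1 &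
      forall Q : {poly int},
        Q != 0 -> root (map_poly intr Q) alpha -> (size P <= size Q)%N].

(* Takes the junk value 0 when alpha is not algebraic. *)
Definition minpolyZ (R : realType) (alpha : R[i]) : {poly int} :=
  xget 0 [set P : {poly int} | is_minpolyZ alpha P].

Definition alg_degree (R : realType) (alpha : R[i]) : nat :=
  (size (minpolyZ alpha)).-1.

Definition alg_height (R : realType) (alpha : R[i]) : nat :=
  poly_height (minpolyZ alpha).

Definition argmin_on (R : realType) (T : Type) (A : set T) (f : T -> R) :
    set T :=
  [set x | A x /\ forall y, A y -> f x <= f y].

(* [size P <= n.+1] means that P has degree at most n. *)
Definition polys_upto (R : realType) (n : nat) (X : R) : set {poly int} :=
  [set P : {poly int} | [/\ P != 0, (size P <= n.+1)%N & (poly_height P)%:R <= X]].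

Definition poly_dist (R : realType) (xi : R) (P : {poly int}) : R :=
  `|(map_poly intr P).[xi]|.

(* Both [polys_upto n X] and [algs_upto n X] are finite, and nonempty for
   X >= 1 (for n >= 1 in the second case), so minimizers exist; the minimal
   value, the only thing used, does not depend on the one [xget] picks. *)
Definition best_poly (R : realType) (n : nat) (xi X : R) : {poly int} :=
  xget 0 (argmin_on (polys_upto n X) (poly_dist xi)).

Definition algs_upto (R : realType) (n : nat) (X : R) : set R[i] :=
  [set alpha : R[i] | [/\ algebraicOver (@ratr R[i]) alpha,
    (alg_degree alpha <= n)%N & (alg_height alpha)%:R <= X]].

(* The modulus of a complex number is an element of R[i], hence the [Re]. *)
Definition alg_dist (R : realType) (xi : R) (alpha : R[i]) : R :=
  (alg_height alpha)%:R * complex.Re `|alpha - real_complex R xi|.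

Definition best_alg (R : realType) (n : nat) (xi X : R) : R[i] :=
  xget 0 (argmin_on (algs_upto n X) (alg_dist xi)).

Definition w (R : realType) (n : nat) (xi X : R) : R :=
  - (ln (poly_dist xi (best_poly n xi X)) / ln X).

Definition wstar (R : realType) (n : nat) (xi X : R) : R :=
  - (ln (alg_dist xi (best_alg n xi X)) / ln X).

Definition w_hat (R : realType) (n : nat) (xi : R) : \bar R :=
  limf_einf (fun X : R => (w n xi X)%:E) (pinfty_nbhs R).

Definition wstar_hat (R : realType) (n : nat) (xi : R) : \bar R :=
  limf_einf (fun X : R => (wstar n xi X)%:E) (pinfty_nbhs R).

(* Main.v *)
Require Import Defs.
From mathcomp Require Import all_boot all_order all_fingroup all_algebra all_field.
From mathcomp Require Import all_classical all_reals all_analysis.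
From mathcomp Require Import complex polyorder.
From mathcomp Require Import zify ring lra.
Set Implicit Arguments.
Unset Strict Implicit.
Unset Printing Implicit Defensive.
Import Order.TTheory GRing.Theory Num.Theory.
Import numFieldNormedType.Exports.
Local Open Scope ring_scope.

(** Suppose that the difference of the exponents exceeds [n - 1]. Then there are
    [omega] and [s] with [eta = omega - s - (n - 1) > 0] such that, for some
    arbitrarily large [X], on the one hand [H(alpha) |xi - alpha| >= X^-s] for
    all algebraic [alpha] of degree at most [n] and height at most [X], and on
    the other hand some non-zero [P] of degree at most [n] has height at most
    [X / C] and [|P(xi)| << X^-omega]. Here and below, constants depend on
    [n], [xi], [omega], [s] only, and [C] is such that the roots of [P] are
    among the numbers [alpha].

    If a squarefree [S] of degree [d] divides [P], the discriminant of [S] is a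
    non-zero integer, and each of its terms contains [S(xi) S''(xi)] or two
    factors among [S(xi)] and [S'(xi)]. The distance from [xi] to the roots of
    [S] bounds [S'(xi) / S(xi)] and [S''(xi) / S(xi)], and the outcome is
    [X^-s << |S(xi)| H(S)^(d-1)] ([squarefree_lower_bound]). With [S = P] this
    contradicts the choice of [omega] and [s], so only repeated factors can be
    responsible for the gap.

    Write [P = A S] with [S] squarefree and divisible by the irreducible
    factors of [A]. The bound for [S] turns into
    [|A(xi)| H(A)^(n-1-deg A) X^(deg A) << X^-eta], because
    [H(A) H(S) << H(P)]. Assume that [A] is a product of [k] irreducible
    factors of the same degree [m]. All of them divide [S], so that
    [H(A)^(k+1) << (H(A) H(S))^k << X^k], and [X] disappears except for the
    gain: [|A(xi)| H(A)^(n+m-1) << X^-eta]. But, provided that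
    [omega > n + m - 1], every irreducible [Q] of degree [m] satisfies
    [|Q(xi)| H(Q)^(n+m-1) >> 1], as one sees from its resultant with a good
    approximation of height just below [H(Q)] ([irreducible_lower_bound]). This
    bound is multiplicative, and we get a contradiction.

    For [n <= 5] the repeated factors are all linear, or there is only one,
    quadratic and of multiplicity two ([squarefree_part]); degree [6] is the
    first in which a linear and a quadratic factor can both be repeated. If
    [m = 1], the proviso [omega > n] follows from [s >= 1], that is, from
    Dirichlet's theorem ([exponent_ge1]). If [m = 2], then [A] is itself
    squarefree, so [X^-s << |A(xi)| H(A)]; compared with the displayed bound
    [|A(xi)| H(A)^(n-3) X^2 << X^-eta], where [n >= 4], this gives [s > 2] and
    therefore [omega > n + 1].

    Heights of polynomials are replaced by the length, the sum of the absolute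
    values of the coefficients, which is of the same order. *)

(** * Lengths of polynomials *)

(** The length is submultiplicative without any constant, which is why it is
    more convenient than the height. *)
Definition plength (C : numDomainType) (p : {poly C}) : C :=
  \sum_(i < size p) `|p`_i|.

Section Length.
Variable C : numDomainType.
Implicit Types (p q r : {poly C}) (a c : C).

Lemma plength_widen p m : (size p <= m)%N ->
  plength p = \sum_(0 <= i < m) `|p`_i|.
Proof.
move=> le_pm; rewrite /plength -(big_mkord xpredT (fun i => `|p`_i|)).
rewrite (@big_cat_nat _ _ _ (size p) 0 m) //= [X in _ + X]big_nat_cond.
rewrite [X in _ + X]big1 ?addr0 // => i /andP[/andP[le_pi _] _].
by rewrite nth_default ?normr0.
Qed.

Lemma plength_ge0 p : 0 <= plength p.
Proof. exact: sumr_ge0. Qed.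

Lemma plengthD p q : plength (p + q) <= plength p + plength q.
Proof.
pose m := maxn (size p) (size q).
rewrite (@plength_widen (p + q) m (size_polyD p q)).
rewrite (@plength_widen p m) ?leq_maxl // (@plength_widen q m) ?leq_maxr //.
by rewrite -big_split /=; apply: ler_sum => i _; rewrite coefD ler_normD.
Qed.

Lemma plengthZ c p : plength (c *: p) = `|c| * plength p.
Proof.
rewrite (plength_widen (size_scale_leq c p)) (@plength_widen p (size p)) //.
by rewrite mulr_sumr; apply: eq_bigr => i _; rewrite coefZ normrM.
Qed.

Lemma plengthMXaddC p c : plength (p * 'X + c%:P) = plength p + `|c|.
Proof.
have le_m : (size (p * 'X + c%:P)%R <= (size p).+1)%N.
  by rewrite size_MXaddC; case: ifP.
rewrite (plength_widen le_m) big_nat_recl //= coefD coefMX coefC /= add0r addrC.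
rewrite (@plength_widen p (size p)) //; congr (_ + _).
by apply: eq_bigr => i _; rewrite coefD coefMX coefC /= addr0.
Qed.

Lemma plengthM p q : plength (p * q) <= plength p * plength q.
Proof.
elim/poly_ind: p => [|p c IHp].
  by rewrite mul0r /plength size_poly0 !big_ord0 mul0r.
rewrite mulrDl mulrAC mul_polyC plengthMXaddC mulrDl -plengthZ.
apply: le_trans (plengthD _ _) _; apply: lerD => //.
by rewrite -[p * q * 'X]addr0 -polyC0 plengthMXaddC normr0 addr0.
Qed.

Lemma plengthXsubC a : plength ('X - a%:P) = 1 + `|a|.
Proof.
rewrite -['X]mul1r -polyCN plengthMXaddC normrN.
by rewrite /plength size_poly1 big_ord1 coef1 normr1.
Qed.

(** Synthetic division by [X - a] expresses each coefficient of the quotient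
    through the higher coefficients of the product when [|a| <= 1], and
    through the lower ones when [|a| >= 1]. *)
Lemma plength_XsubC_mul a r :
  (1 + `|a|) * plength r
    <= (2 * size r)%N%:R * plength (('X - a%:P) * r).
Proof.
set p := _ * r; pose L := plength p.
have [->|r0] := eqVneq r 0.
  by rewrite /plength size_poly0 big_ord0 mulr0 mulr_ge0 ?plength_ge0.
have szp : size p = (size r).+1.
  by rewrite size_monicM ?monicXsubC // size_XsubC.
have p_0 : p`_0 = - (a * r`_0).
  by rewrite /p mulrBl coefB coefXM coefCM /= sub0r.
have p_S j : p`_j.+1 = r`_j - a * r`_j.+1.
  by rewrite /p mulrBl coefB coefXM coefCM.
have suff_coef b : 0 <= b -> (forall j, b * `|r`_j| <= L) ->
    b * plength r <= (size r)%:R * L.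
  move=> b0 le_b; rewrite mulr_sumr.
  apply: le_trans (_ : \sum_(i < size r) L <= _).
    by apply: ler_sum => i _; exact: le_b.
  by rewrite sumr_const card_ord mulr_natl.
rewrite natrM -mulrA.
have [le_a1|le_1a] := real_leP (normr_real a) (@real1 C).
  have le_r j : `|r`_j| <= L.
    have H k : (j + k = size r)%N \/ (size r <= j)%N ->
      `|r`_j| <= \sum_(j.+1 <= i < size p) `|p`_i|.
      elim: k j => [|k IHk] j; case=> [jk|jr].
      - by rewrite nth_default ?normr0 ?sumr_ge0 // -jk addn0.
      - by rewrite nth_default ?normr0 ?sumr_ge0.
      - rewrite big_ltn; last by rewrite szp; lia.
        have -> : r`_j = p`_j.+1 + a * r`_j.+1 by rewrite p_S subrK.
        apply: le_trans (ler_normD _ _) _; apply: lerD => //.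
        rewrite normrM; apply: le_trans (_ : `|r`_j.+1| <= _).
          by rewrite ler_piMl.
        by apply: IHk; left; lia.
      - by rewrite nth_default ?normr0 ?sumr_ge0.
    have [jr|jr] := leqP (size r) j.
      by rewrite nth_default ?normr0 ?plength_ge0.
    apply: le_trans (H (size r - j)%N _) _; first by left; lia.
    rewrite /L (@plength_widen p (size p)) // (@big_cat_nat _ _ _ j.+1 0 (size p)) //=.
      by rewrite lerDr sumr_ge0.
    by rewrite szp; lia.
  apply: le_trans (_ : 2 * plength r <= _).
    by rewrite ler_wpM2r ?plength_ge0 // -natr1 mulr1n addrC lerD.
  rewrite ler_wpM2l //.
  have := suff_coef 1 ler01; rewrite mul1r; apply => j; by rewrite mul1r.
have le_1a' := ltW le_1a.
have le_r j : `|a| * `|r`_j| <= L.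
  apply: le_trans (_ : \sum_(0 <= i < j.+1) `|p`_i| <= _).
    elim: j => [|j IHj].
      by rewrite big_nat1 p_0 normrN normrM.
    rewrite big_nat_recr //=.
    have -> : `|a| * `|r`_j.+1| = `|r`_j - p`_j.+1|.
      by rewrite p_S opprB addrCA subrr addr0 normrM.
    apply: le_trans (ler_normB _ _) _; apply: lerD => //.
    by apply: le_trans IHj; rewrite ler_peMl.
  rewrite /L (@plength_widen p (maxn (size p) j.+1)) ?leq_maxl //.
  rewrite [leRHS](@big_cat_nat _ _ _ j.+1) ?leq_maxr //=.
  by rewrite lerDl sumr_ge0.
apply: le_trans (_ : 2 * (`|a| * plength r) <= _).
  by rewrite mulrA ler_wpM2r ?plength_ge0 // mulr2n mulrDl !mul1r lerD2r.
by rewrite ler_wpM2l // suff_coef.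
Qed.

End Length.

(** Dividing by one linear factor after the other, an upper bound for the
    length of a factor is traded for a lower bound for the product. *)
Lemma plengthM_ge (C : numClosedFieldType) (n : nat) (p q : {poly C}) :
  p != 0 -> q != 0 -> (size (p * q)%R <= n.+1)%N ->
  plength p * plength q <= ((2 * n) ^ n)%N%:R * plength (p * q).
Proof.
move=> p0 q0 sz_pq.
have [rs Dp] := closed_field_poly_normal p.
have c0 : lead_coef p != 0 by rewrite lead_coef_eq0.
have sz_p : size p = (size rs).+1.
  by rewrite Dp size_scale // size_prod_XsubC.
have main s : (size (\prod_(z <- s) ('X - z%:P) * q)%R <= n.+1)%N ->
    plength (\prod_(z <- s) ('X - z%:P)) * plength q
    <= (2 * n)%N%:R ^+ size s * plength (\prod_(z <- s) ('X - z%:P) * q).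
  elim: s => [|a s IHs].
    by rewrite !big_nil expr0 !mul1r /plength size_poly1 big_ord1 coef1 normr1 mul1r.
  rewrite !big_cons -mulrA; set r := \prod_(j <- s) _ in IHs *.
  have rq0 : r * q != 0.
    by rewrite mulf_neq0 // monic_neq0 // monic_prod_XsubC.
  rewrite size_monicM ?monicXsubC // size_XsubC /= => szrq.
  apply: le_trans (_ : (1 + `|a|) * (plength r * plength q) <= _).
    by rewrite mulrA ler_wpM2r ?plength_ge0 // -plengthXsubC plengthM.
  have {}IHs := IHs (ltnW szrq).
  apply: le_trans (ler_wpM2l _ IHs) _; first by rewrite addr_ge0.
  rewrite mulrCA exprS [_ * _ ^+ _]mulrC -mulrA ler_wpM2l ?exprn_ge0 //.
  apply: le_trans (plength_XsubC_mul _ _) _.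
  rewrite ler_wpM2r ?plength_ge0 // ler_nat leq_mul2l /=; exact: szrq.
have le_rs : (size rs <= n)%N.
  have := sz_pq; rewrite size_mul // sz_p; move: q0; rewrite -size_poly_gt0.
  by case: (size q) => // k _; rewrite addnS ltnS => /(leq_trans (leq_addr _ _)).
rewrite Dp -scalerAl !plengthZ -!mulrA [leRHS]mulrCA ler_wpM2l //.
apply: le_trans (main rs _) _.
  by rewrite -(@size_scale _ (lead_coef p)) // scalerAl -Dp.
rewrite ler_wpM2r ?plength_ge0 // -natrX ler_nat.
case: (n) le_rs => [|k] le_rs; first by move: le_rs; rewrite leqn0 => /eqP->.
by rewrite leq_pexp2l // muln_gt0.
Qed.

Definition zlength (P : {poly int}) : nat := (\sum_(i < size P) absz (P`_i)%R)%N.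

Lemma zlengthE (C : numDomainType) (P : {poly int}) :
  (zlength P)%:R = plength (map_poly (intr : int -> C) P).
Proof.
rewrite /zlength /plength size_map_inj_poly ?mulr0z //; last exact: intr_inj.
by rewrite natr_sum; apply: eq_bigr => i _; rewrite coef_map /= natr_absz intr_norm.
Qed.

Lemma zlengthM_ge (n : nat) (P Q : {poly int}) :
  P * Q != 0 -> (size (P * Q)%R <= n.+1)%N ->
  (zlength P * zlength Q <= (2 * n) ^ n * zlength (P * Q)%R)%N.
Proof.
rewrite mulf_eq0 negb_or => /andP[P0 Q0] szPQ.
have inj0 (p : {poly int}) : p != 0 -> map_poly intr p != 0 :> {poly algC}.
  by move=> p0; rewrite map_poly_eq0_id0 ?intr_eq0 ?lead_coef_eq0.
rewrite -(ler_nat algC) !natrM !zlengthE rmorphM /=.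
apply: plengthM_ge; [exact: inj0| exact: inj0|rewrite -rmorphM /=;
  by rewrite size_map_inj_poly ?mulr0z //; exact: intr_inj].
Qed.

Lemma zlengthM (P Q : {poly int}) :
  (zlength (P * Q)%R <= zlength P * zlength Q)%N.
Proof. by rewrite -(ler_nat int) natrM !zlengthE rmorphM /= plengthM. Qed.

(* General facts on sizes, with [{poly int}] as the literal type: otherwise
   arithmetic tactics do not identify the occurrences of [size P]. *)
Lemma zsize_mul (P Q : {poly int}) : P != 0 -> Q != 0 ->
  size (P * Q) = (size P + size Q).-1.
Proof. exact: size_mul. Qed.

Lemma zsize_dvd (P Q : {poly int}) : Q != 0 -> P %| Q -> (size P <= size Q)%N.
Proof. exact: dvdp_leq. Qed.

Lemma zsize_irreducible (P : {poly int}) : irreducible_poly P -> (1 < size P)%N.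
Proof. by case. Qed.

Lemma zsize_gt0 (P : {poly int}) : P != 0 -> (0 < size P)%N.
Proof. by rewrite size_poly_gt0. Qed.

Lemma zsize_XnM k (f : {poly int}) : (size ('X^k * f)%R <= k + size f)%N.
Proof.
have [->|f0] := eqVneq f 0; first by rewrite mulr0 size_poly0.
by rewrite size_monicM ?monicXn // size_polyXn.
Qed.

Lemma coef_le_zlength (f : {poly int}) i : (absz (f`_i)%R <= zlength f)%N.
Proof.
have [le_fi|lt_if] := leqP (size f) i; first by rewrite nth_default.
by rewrite /zlength (bigD1 (Ordinal lt_if)) //= leq_addr.
Qed.

Lemma zlengthD (f g : {poly int}) : (zlength (f + g)%R <= zlength f + zlength g)%N.
Proof. by rewrite -(ler_nat int) natrD !zlengthE rmorphD /= plengthD. Qed.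

Lemma zlengthZ c (f : {poly int}) : zlength (c *: f) = (absz c * zlength f)%N.
Proof.
apply/eqP; rewrite -(eqr_nat int) natrM !zlengthE map_polyZ plengthZ /=.
by rewrite natr_absz intr_norm.
Qed.

Lemma zlengthN (f : {poly int}) : zlength (- f) = zlength f.
Proof. by rewrite -scaleN1r zlengthZ mul1n. Qed.

Lemma zlength_Xn k : zlength 'X^k = 1%N.
Proof.
rewrite /zlength size_polyXn big_ord_recr /= coefXn eqxx big1 // => i _.
by rewrite coefXn ltn_eqF ?ltn_ord.
Qed.

Lemma zlength1 : zlength 1 = 1%N.
Proof. by rewrite -(zlength_Xn 0) expr0. Qed.

Lemma zlengthC c : zlength c%:P = absz c.
Proof. by rewrite -alg_polyC zlengthZ zlength1 muln1. Qed.

Lemma zlength_deriv (f : {poly int}) : (zlength f^`() <= size f * zlength f)%N.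
Proof.
have [->|f0] := eqVneq f 0; first by rewrite linear0 /zlength size_poly0 big_ord0.
have szf := zsize_gt0 f0.
rewrite {1}/zlength size_deriv; case Ef: (size f) => [|k] /=; first by rewrite big_ord0.
rewrite /zlength Ef big_ord_recl /= mulnDr -[leqLHS]add0n leq_add //.
rewrite big_distrr; apply: leq_sum => i _ /=.
rewrite coef_deriv -mulr_natr abszM natz mulnC leq_mul //=.
exact: ltnW (ltn_ord i).
Qed.

Lemma zlength_XnM k (f : {poly int}) : (zlength ('X^k * f)%R <= zlength f)%N.
Proof. by rewrite (leq_trans (zlengthM _ _)) // zlength_Xn mul1n. Qed.

Lemma zlength_gt0 (f : {poly int}) : f != 0 -> (0 < zlength f)%N.
Proof.
move=> f0; apply: leq_trans (coef_le_zlength f (size f).-1).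
by rewrite absz_gt0 -lead_coefE lead_coef_eq0.
Qed.

(** A primitive divisor over the rationals is a divisor over the integers, whose
    cofactor has length at least [1]. *)
Lemma zlength_dvd n (P Q : {poly int}) : P != 0 -> (size P <= n.+1)%N ->
  zcontents Q = 1 -> Q %| P -> (zlength Q <= (2 * n) ^ n * zlength P)%N.
Proof.
move=> P0 szP cQ QP; have [B DP] := dvdpP_int QP.
have prQ : zprimitive Q = Q by have := zpolyEprim Q; rewrite cQ scale1r => <-.
rewrite prQ in DP; have B0 : B != 0 by apply: contraNneq P0 => B0; rewrite DP B0 mulr0.
rewrite DP; apply: leq_trans (zlengthM_ge _ _); rewrite -?DP //.
by rewrite leq_pmulr // zlength_gt0.
Qed.

(** * Repeated factors of integer polynomials *)

Lemma eqp_zprimitive (P : {poly int}) : P != 0 -> zprimitive P %= P.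
Proof.
move=> P0; rewrite {2}[P]zpolyEprim eqp_sym eqp_scale //.
by rewrite zcontents_eq0.
Qed.

Lemma eqp_irreducible (R : idomainType) (p q : {poly R}) :
  p %= q -> irreducible_poly p -> irreducible_poly q.
Proof.
move=> pq irr_p; split=> [|d d1 dq]; first by rewrite -(eqp_size pq); case: irr_p.
rewrite eqp_sym; apply: eqp_trans (_ : p %= d); rewrite eqp_sym //.
  by apply: irr_p; rewrite // (eqp_dvdr _ pq).
Qed.

Lemma irreducible_coprimep (R : idomainType) (p q : {poly R}) :
  irreducible_poly p -> ~~ (p %| q) -> coprimep p q.
Proof.
move=> irr_p; apply: contraR => cpq; rewrite -(eqp_dvdl _ (_ : gcdp p q %= p)).
  exact: dvdp_gcdr.
by apply: irr_p; rewrite ?dvdp_gcdl // -coprimep_def.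
Qed.

Lemma irreducible_dvdM (R : idomainType) (p q r : {poly R}) :
  irreducible_poly p -> p %| q * r -> (p %| q) || (p %| r).
Proof.
move=> irr_p dv; have [//|/(irreducible_coprimep irr_p) co] := boolP (p %| q).
by rewrite -(Gauss_dvdpr _ co).
Qed.

Lemma irreducible_divisor (R : idomainType) (p : {poly R}) :
  (1 < size p)%N -> exists2 q : {poly R}, irreducible_poly q & q %| p.
Proof.
have [m] := ubnP (size p); elim: m => // m IHm in p *; rewrite ltnS => le_pm p1.
have [irr_p|nirr] := pselect (irreducible_poly p).
  by exists p.
have [q [q1 qp nqp]] : exists q : {poly R}, [/\ size q != 1%N, q %| p & ~~ (q %= p)].
  apply: contrapT => no.
  case: nirr; split=> // q q1 qp; apply/negPn/negP => nqp.
  by case: no; exists q.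
have p0 : p != 0 by rewrite -size_poly_gt0 ltnW.
have lt_qp : (size q < size p)%N.
  by rewrite ltn_neqAle dvdp_leq // andbT (dvdp_size_eqp qp).
have q0 : (0 < size q)%N by rewrite size_poly_gt0; apply: dvdpN0 qp p0.
have [||r irr_r rq] := IHm q; [exact: leq_trans le_pm | by lia |].
by exists r; rewrite // (dvdp_trans rq).
Qed.

(** A common irreducible factor [q] of [p = q * b] and of
    [p' = q' * b + q * b'] divides [q' * b], hence [b], because [q'] is non-zero
    of smaller degree. *)
Lemma square_divisor (P : {poly int}) : P != 0 -> ~~ coprimep P P^`() ->
  exists Q R : {poly int},
    [/\ irreducible_poly Q, zcontents Q = 1 & P = Q * Q * R].
Proof.
move=> P0; rewrite coprimep_def => nco.
have g0 : gcdp P P^`() != 0 by rewrite gcdp_eq0 negb_and P0.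
have [|q0 irr0] := @irreducible_divisor _ (gcdp P P^`()).
  by move: g0; rewrite -size_poly_gt0; lia.
have q00 := irredp_neq0 irr0.
rewrite dvdp_gcd => /andP[q0P q0P'].
pose q := zprimitive q0; have qq0 := eqp_zprimitive q00.
have irr_q : irreducible_poly q by apply: eqp_irreducible irr0; rewrite eqp_sym.
have cq : zcontents q = 1 by rewrite zcontents_primitive q00.
have prim_q : zprimitive q = q by rewrite zprimitive_id.
have q_n0 := irredp_neq0 irr_q.
have [B DP] := dvdpP_int q0P; rewrite -/q in DP.
have qB : q %| B.
  have : q %| q^`() * B.
    move: q0P'; rewrite -(eqp_dvdl _ qq0) DP derivM.
    by rewrite dvdp_addl // dvdp_mulr.
  case/(irreducible_dvdM irr_q)/orP => // qq'.
  have q'0 : q^`() != 0.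
    rewrite -size_poly_gt0 size_deriv.
    by have [] := irr_q; case: (size q) => [|[]].
  by have := leq_ltn_trans (dvdp_leq q'0 qq') (lt_size_deriv q_n0); rewrite ltnn.
have [R DB] := dvdpP_int qB; exists q, R; split=> //.
by rewrite DP DB prim_q mulrA.
Qed.

(** A repeated factor of degree at least [3] takes up degree [6] or more, and so
    does a repeated quadratic factor together with another repeated factor, or
    occurring three times. This leaves repeated linear factors, which are
    extracted one by one, and a single quadratic factor occurring twice. *)
Lemma squarefree_part (P : {poly int}) : P != 0 -> (size P <= 6)%N ->
  exists (m : nat) (s : seq {poly int}) (S : {poly int}),
    [/\ P = \prod_(Q <- s) Q * S, coprimep S S^`(),
        forall Q, Q \in s ->
          [/\ irreducible_poly Q, zcontents Q = 1, size Q = m.+1 & Q %| S] &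
        m = 1%N \/ m = 2%N /\ size s = 1%N].
Proof.
move=> P0 szP.
have [[Q [R [irrQ cQ szQ DP]]]|lin] := pselect
  (exists Q R : {poly int},
    [/\ irreducible_poly Q, zcontents Q = 1, size Q != 2%N & P = Q * Q * R]).
  have Q0 := irredp_neq0 irrQ; have szQ1 := zsize_irreducible irrQ.
  have R0 : R != 0 by apply: contraNneq P0 => R0; rewrite DP R0 mulr0.
  have R_gt0 := zsize_gt0 R0.
  have szPE : (size P = (size Q + size Q + size R) - 2)%N.
    rewrite DP !zsize_mul ?mulf_neq0 //; lia.
  exists 2%N, [:: Q], (Q * R); split; last by right.
  - by rewrite big_seq1 mulrA.
  - apply/negPn/negP => /square_divisor[|L [B [irrL _ DL]]].
      by rewrite mulf_neq0.
    have szL1 := zsize_irreducible irrL; have L0 := irredp_neq0 irrL.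
    have B0 : B != 0.
      by apply: contraNneq (mulf_neq0 Q0 R0) => B0; rewrite DL B0 mulr0.
    have szLR : ~~ (L * L %| R).
      apply/negP => /(zsize_dvd R0); rewrite zsize_mul //; lia.
    have [LQ|nLQ] := boolP (L %| Q).
      have LQe : L %= Q by apply: irrQ; rewrite // gtn_eqF.
      have szLQ : size L = size Q := eqp_size LQe.
      have : L %| R.
        have : L * L %| Q * R by rewrite DL dvdp_mulIl.
        rewrite (eqp_dvdl _ (eqp_mulr L LQe)) dvdp_mul2l //.
      by move/(zsize_dvd R0); lia.
    case/negP: szLR; have co := irreducible_coprimep irrL nLQ.
    rewrite -(Gauss_dvdpr R (_ : coprimep (L * L) Q)) ?DL ?dvdp_mulIl //.
    by rewrite coprimepMl co.
  - move=> L; rewrite inE => /eqP->; split=> //; last exact: dvdp_mulIl.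
    lia.
have : forall k, (size P <= k)%N -> exists (s : seq {poly int}) (S : {poly int}),
    [/\ P = \prod_(Q <- s) Q * S, coprimep S S^`() &
        forall Q, Q \in s ->
          [/\ irreducible_poly Q, zcontents Q = 1, size Q = 2%N & Q %| S]].
  move=> k; move: {szP} P P0 lin; elim: k => [|k IHk] P P0 lin.
    by rewrite leqn0 size_poly_eq0 (negPf P0).
  move=> szP; have [co|nco] := boolP (coprimep P P^`()).
    by exists [::], P; split=> //; rewrite big_nil mul1r.
  have [Q [R [irrQ cQ DP]]] := square_divisor P0 nco.
  have Q0 := irredp_neq0 irrQ.
  have QR0 : Q * R != 0.
    by apply: contraNneq P0 => QR0; rewrite DP -mulrA QR0 mulr0.
  have szQ : size Q = 2%N.
    by apply/eqP/negPn/negP => szQ; apply: lin; exists Q, R.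
  have [||s [S [DQR coS sS]]] := IHk (Q * R) QR0.
  - case=> L [B [irrL cL szL DL]]; apply: lin; exists L, (Q * B); split=> //.
    by rewrite DP -mulrA DL mulrCA.
  - by move: szP; rewrite DP -mulrA zsize_mul // szQ.
  exists (Q :: s), S; split=> //; first by rewrite big_cons DP -!mulrA -DQR.
  move=> L; rewrite inE => /predU1P[->|/sS//]; split=> //.
  have : Q %| \prod_(L <- s) L * S by rewrite -DQR dvdp_mulIl.
  case/(irreducible_dvdM irrQ)/orP => // Qs {L}.
  have [M Ms QM] : exists2 M, M \in s & Q %| M.
    elim: (s) Qs => [|M t IHt].
      rewrite big_nil => /dvdp_leq; rewrite oner_neq0 szQ size_poly1; by move/(_ isT).
    rewrite big_cons => /(irreducible_dvdM irrQ)/orP[QM|/IHt[N Nt QN]].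
      by exists M; rewrite ?mem_head.
    by exists N; rewrite // inE Nt orbT.
  by have [_ _ _] := sS _ Ms; apply: dvdp_trans.
by move=> /(_ _ (leqnn _)) [s [S [DP co sS]]]; exists 1%N, s, S; split=> //; left.
Qed.

(** * Determinants with small columns *)

Section Determinants.
Variable R : realFieldType.

Lemma norm_sum_perm_le (N : nat) (F : 'S_N -> R) (b : R) :
  (forall s, `|F s| <= b) -> `|\sum_s F s| <= N`!%:R * b.
Proof.
move=> leF; apply: le_trans (ler_norm_sum _ _ _) _.
apply: le_trans (_ : \sum_(s : 'S_N) b <= _); first exact: ler_sum.
by rewrite sumr_const cardT -cardE card_Sn mulr_natl.
Qed.

(** If the entries of the first column are smaller by a factor [theta] than
    those of the other columns, so is every term of the Leibniz expansion. *)
Lemma norm_det_le (N : nat) (A : 'M[R]_N.+1) (rho : 'I_N.+1 -> R) (theta : R) :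
  (forall i j, `|A i j| <= rho i) -> (forall i, `|A i 0| <= theta * rho i) ->
  `|\det A| <= (N.+1)`!%:R * (theta * \prod_i rho i).
Proof.
move=> leA leA0; apply: norm_sum_perm_le => s.
rewrite normrM normrX normrN1 expr1n mul1r normr_prod.
rewrite (bigD1 (perm_inv s 0)) //= [\prod_i rho i](bigD1 (perm_inv s 0)) //= mulrA.
apply: ler_pM; [by []|by apply: prodr_ge0| |].
  by rewrite permKV.
by apply: ler_prod => i _; rewrite normr_ge0 leA.
Qed.

(** Pairing each permutation with its composition with the transposition of the
    first two columns collects the minors of these columns: twice the
    determinant is a signed sum of products of one such minor by entries of
    the other columns. *)
Lemma norm_det_le_minor (N : nat) (A : 'M[R]_N.+2) (W rho : R) :
  let j1 : 'I_N.+2 := lift ord0 ord0 in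
  (forall i k, `|A i 0 * A k j1 - A k 0 * A i j1| <= W) ->
  (forall i (j : 'I_N), `|A i (lift ord0 (lift ord0 j))| <= rho) ->
  `|\det A| <= (N.+2)`!%:R * (W * rho ^+ N).
Proof.
move=> j1 leW le_rho.
pose rest (s : 'S_N.+2) :=
  \prod_(j : 'I_N) A (s (lift ord0 (lift ord0 j))) (lift ord0 (lift ord0 j)).
pose F (s : 'S_N.+2) : R := (-1) ^+ s * (A (s 0) 0 * A (s j1) j1 * rest s).
pose G (s : 'S_N.+2) : R := (-1) ^+ s * (A (s j1) 0 * A (s 0) j1 * rest s).
have detF : \det A = \sum_s F s.
  rewrite -det_tr; apply: eq_bigr => s _; congr (_ * _).
  rewrite !big_ord_recl !mxE -!mulrA; congr (_ * (_ * _)).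
  by apply: eq_bigr => j _; rewrite mxE.
have detG : \det A = - \sum_s G s.
  rewrite detF (reindex_inj (mulgI (tperm 0 j1))) /= -sumrN.
  apply: eq_bigr => s _; rewrite /F /G odd_mul_tperm /= signrN mulNr.
  congr (- (_ * _)); rewrite -!mulrA !permM tpermL tpermR; congr (_ * (_ * _)).
  by apply: eq_bigr => j _; rewrite permM tpermD.
have -> : \det A = (\sum_s (F s - G s)) / 2.
  by rewrite sumrB -detF; have := detG; lra.
have W0 : 0 <= W := le_trans (normr_ge0 _) (leW 0 0).
suff : `|\sum_s (F s - G s)| <= (N.+2)`!%:R * (W * rho ^+ N).
  rewrite normrM [`|2^-1|]ger0_norm ?invr_ge0 //.
  by have := normr_ge0 (\sum_s (F s - G s)); lra.
apply: norm_sum_perm_le => s.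
have -> : F s - G s =
    (-1) ^+ s * ((A (s 0) 0 * A (s j1) j1 - A (s j1) 0 * A (s 0) j1) * rest s).
  by rewrite /F /G -mulrBr -mulrBl.
rewrite !normrM normrX normrN1 expr1n mul1r ler_pM //.
rewrite normr_prod -[N in rho ^+ N]card_ord -prodr_const.
by apply: ler_prod => i _; rewrite normr_ge0 le_rho.
Qed.

End Determinants.

Definition zeval (R : realFieldType) (xi : R) (f : {poly int}) : R :=
  (map_poly intr f).[xi].

Section Evaluation.
Variables (R : realFieldType) (xi : R).
Local Notation ev := (zeval xi).
Local Notation b := (1 + `|xi|).
Implicit Types (f g : {poly int}).

Lemma zevalM f g : ev (f * g) = ev f * ev g.
Proof. by rewrite /zeval rmorphM hornerM. Qed.

Lemma zevalD f g : ev (f + g) = ev f + ev g.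
Proof. by rewrite /zeval rmorphD hornerD. Qed.

Lemma norm_zeval_le m f : (size f <= m.+1)%N ->
  `|ev f| <= b ^+ m * (zlength f)%:R.
Proof.
move=> szf; rewrite /zeval horner_coef size_map_inj_poly ?mulr0z //; last exact: intr_inj.
apply: le_trans (ler_norm_sum _ _ _) _.
rewrite /zlength natr_sum mulr_sumr; apply: ler_sum => i _.
rewrite normrM normrX coef_map /= mulrC -intr_norm -abszE ler_wpM2r //.
apply: le_trans (_ : b ^+ i <= _); first by rewrite lerXn2r ?nnegrE ?lerDr ?addr_ge0.
by rewrite ler_weXn2l ?lerDl // -ltnS (leq_trans (ltn_ord i)).
Qed.

Lemma norm_coef_le_zlength f i : `|(f`_i)%:~R| <= (zlength f)%:R :> R.
Proof. by rewrite -intr_norm -abszE ler_nat coef_le_zlength. Qed.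

(** Column operations replace the first two columns of a matrix of
    coefficients by the values of the row polynomials and of their derivatives
    at [xi]. *)
Lemma det_coef_zeval (N : nat) (g : 'I_N.+2 -> {poly int}) :
  (forall i, (size (g i) <= N.+2)%N) ->
  (\det (\matrix_(i, j) (g i)`_j))%:~R =
  \det (\matrix_(i, j < N.+2)
          if j == 0 then ev (g i)
          else if j == 1 then ev (g i)^`() else ((g i)`_j)%:~R).
Proof.
move=> szg; set A := \matrix_(i, j) _; set B := \matrix_(i, j) _.
pose U : 'M[R]_N.+2 := \matrix_(j, k)
  if k == 0 then xi ^+ j else if k == 1 then xi ^+ j.-1 *+ j else (j == k)%:R.
have detU : \det U = 1.
  rewrite det_trig; last first.
    apply/is_trig_mxP => j k lt_jk; rewrite mxE.
    have [k0|_] := eqVneq k 0; first by rewrite k0 in lt_jk.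
    have [k1|_] := eqVneq k 1; last by rewrite -val_eqE /= ltn_eqF.
    by move: lt_jk; rewrite k1 /= ltnS leqn0 => /eqP->.
  rewrite big1 // => i _; rewrite mxE eqxx.
  have [->|_] := eqVneq i 0; first by rewrite expr0.
  by have [->|_] := eqVneq i 1; rewrite //= modn_small.
have EB : B = map_mx intr A *m U.
  apply/matrixP => i k; rewrite !mxE.
  have [k0|k0] := eqVneq k 0; last have [k1|k1] := eqVneq k 1.
  - rewrite /zeval (@horner_coef_wide _ N.+2).
      by apply: eq_bigr => j _; rewrite !mxE coef_map k0 eqxx.
    by rewrite size_map_inj_poly ?mulr0z //; exact: intr_inj.
  - have -> : g i = \sum_(j < N.+2) (g i)`_j *: 'X^j.
      rewrite -poly_def; apply/polyP => j; rewrite coef_poly.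
      by case: ltnP => // /(leq_trans (szg i)) le_gj; rewrite nth_default.
    rewrite /zeval linear_sum rmorph_sum horner_sum /=; apply: eq_bigr => j _.
    rewrite !mxE (negPf k0) k1 eqxx derivZ derivXn map_polyZ hornerZ /=.
    by rewrite raddfMn /= map_polyXn hornerMn hornerXn.
  - rewrite (bigD1 k) //= !mxE (negPf k0) (negPf k1) eqxx mulr1.
    rewrite big1 ?addr0 // => j jk.
    by rewrite !mxE (negPf k0) (negPf k1) (negPf jk) mulr0.
by rewrite EB det_mulmx detU mulr1 det_map_mx.
Qed.

Lemma det_coef_ge1 (N : nat) (g : 'I_N.+2 -> {poly int}) :
  (forall i, (size (g i) <= N.+2)%N) ->
  \det (\matrix_(i, j) (g i)`_j) != 0 ->
  1 <= `|\det (\matrix_(i, j < N.+2)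
          if j == 0 then ev (g i)
          else if j == 1 then ev (g i)^`() else ((g i)`_j)%:~R)|.
Proof.
move=> szg det0; rewrite -det_coef_zeval // -intr_norm -abszE.
by rewrite ler1n absz_gt0.
Qed.

End Evaluation.

(** * Lower bounds from resultants and discriminants *)

Definition Sylvester_row (F G : {poly int}) (i : nat) : {poly int} :=
  if (i < (size G).-1)%N then 'X^i * F else 'X^(i - (size G).-1) * G.

Lemma det_Sylvester_row (F G : {poly int}) (N : nat) :
  ((size G).-1 + (size F).-1)%N = N ->
  \det (\matrix_(i < N, j < N) (Sylvester_row F G i)`_j) = resultant F G.
Proof.
move=> <-; congr (\det _); apply/matrixP => i j; rewrite mxE Sylvester_mxE.
rewrite /Sylvester_row; case: splitP => k ->.
  by rewrite coefXnM ltnNge; case: leqP; rewrite ?mulr1n ?mulr0n.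
by rewrite addKn coefXnM ltnNge; case: leqP; rewrite ?mulr1n ?mulr0n.
Qed.

Lemma coprimep_det_Sylvester_row (F G : {poly int}) (N : nat) :
  ((size G).-1 + (size F).-1)%N = N -> coprimep F G ->
  \det (\matrix_(i < N, j < N) (Sylvester_row F G i)`_j) != 0.
Proof.
move=> /det_Sylvester_row-> co; rewrite resultant_eq0.
by move: co; rewrite coprimep_def => /eqP->.
Qed.

Lemma prod_if_ltn (R : comNzRingType) (N a : nat) (x y : R) : (a <= N)%N ->
  \prod_(i < N) (if (i < a)%N then x else y) = x ^+ a * y ^+ (N - a).
Proof.
move=> aN; rewrite -(big_mkord xpredT (fun i => if (i < a)%N then x else y)).
rewrite (@big_cat_nat _ _ _ a) //=; congr (_ * _).
  rewrite -[a in RHS]subn0 -prodr_const_nat big_nat [RHS]big_nat.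
  by apply: eq_bigr => i /andP[_ ->].
rewrite -prodr_const_nat big_nat [RHS]big_nat.
by apply: eq_bigr => i /andP[ai _]; rewrite ltnNge ai.
Qed.

(** With [f = u * p + v * p'], the second derivative [p''] enters the Wronskian
    of two such functions only through the product [p * p'']. *)
Lemma wronskian_le (R : realFieldType) (p p' p'' T K : R)
    (u1 v1 u1' v1' u2 v2 u2' v2' : R) :
  `|p| <= T -> `|p'| <= T -> `|p * p''| <= T ^+ 2 ->
  `|u1| <= K -> `|v1| <= K -> `|u1'| <= K -> `|v1'| <= K ->
  `|u2| <= K -> `|v2| <= K -> `|u2'| <= K -> `|v2'| <= K ->
  `|(u1 * p + v1 * p') * (u2' * p + u2 * p' + (v2' * p' + v2 * p''))
    - (u2 * p + v2 * p') * (u1' * p + u1 * p' + (v1' * p' + v1 * p''))|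
  <= 14 * K ^+ 2 * T ^+ 2.
Proof.
move=> pT p'T ppT hu1 hv1 hu1' hv1' hu2 hv2 hu2' hv2'.
have T0 : 0 <= T := le_trans (normr_ge0 _) pT.
have K0 : 0 <= K := le_trans (normr_ge0 _) hu1.
have nM (x y a c : R) : `|x| <= a -> `|y| <= c -> `|x * y| <= a * c.
  by move=> xa yc; rewrite normrM ler_pM.
have nD (x y a c : R) : `|x| <= a -> `|y| <= c -> `|x + y| <= a + c.
  by move=> xa yc; apply: le_trans (ler_normD _ _) _; apply: lerD.
have nB (x y a c : R) : `|x| <= a -> `|y| <= c -> `|x - y| <= a + c.
  by move=> xa yc; apply: le_trans (ler_normB _ _) _; apply: lerD.
have -> : (u1 * p + v1 * p') * (u2' * p + u2 * p' + (v2' * p' + v2 * p''))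
    - (u2 * p + v2 * p') * (u1' * p + u1 * p' + (v1' * p' + v1 * p''))
  = (p * p'') * (u1 * v2 - u2 * v1)
    + ((u1 * p + v1 * p') * (u2' * p + (u2 + v2') * p')
       - (u2 * p + v2 * p') * (u1' * p + (u1 + v1') * p')) by ring.
have -> : 14 * K ^+ 2 * T ^+ 2 = T ^+ 2 * (K * K + K * K)
  + ((K * T + K * T) * (K * T + (K + K) * T)
     + (K * T + K * T) * (K * T + (K + K) * T)) by ring.
by apply: (nD); [apply: (nM) => //; apply: (nB) | apply: (nB); apply: (nM);
  apply: (nD)]; try apply: (nM) => //; apply: (nD).
Qed.

Section Resultants.
Variables (R : realFieldType) (xi : R).
Local Notation ev := (zeval xi).
Local Notation b := (1 + `|xi|).

Let b1 : 1 <= b. Proof. by rewrite lerDl. Qed.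
Let bX0 k : 0 <= b ^+ k. Proof. by rewrite exprn_ge0 // (le_trans ler01). Qed.

Lemma norm_zeval_XnM k n f : (k <= n)%N -> `|ev ('X^k * f)| <= b ^+ n * `|ev f|.
Proof.
move=> kn; rewrite zevalM normrM ler_wpM2r // /zeval map_polyXn hornerXn normrX.
apply: le_trans (_ : b ^+ k <= _).
  by rewrite lerXn2r ?nnegrE ?lerDr ?addr_ge0.
by rewrite ler_weXn2l.
Qed.

Lemma norm_zeval_deriv_le m (f : {poly int}) : (size f <= m)%N ->
  `|ev f^`()| <= (m%:R * b ^+ m) * (zlength f)%:R.
Proof.
move=> szf; have szf' : (size f^`() <= m.+1)%N.
  by rewrite size_deriv (leq_trans (leq_pred _)) // leqW.
apply: le_trans (norm_zeval_le xi szf') _.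
rewrite [leRHS]mulrAC [leRHS]mulrC ler_wpM2l //.
by rewrite -natrM ler_nat (leq_trans (zlength_deriv f)) // leq_mul2r szf orbT.
Qed.

(** The resultant of coprime integer polynomials is a non-zero integer, and
    its first column can be made to hold values at [xi]. *)
Lemma resultant_lower_bound (n : nat) : exists2 K : R, 0 < K &
  forall F G : {poly int}, coprimep F G ->
    (1 < size F <= n.+1)%N -> (1 < size G <= n.+1)%N ->
    1 <= K * ((`|ev F| / (zlength F)%:R + `|ev G| / (zlength G)%:R)
           * ((zlength F)%:R ^+ (size G).-1 * (zlength G)%:R ^+ (size F).-1)).
Proof.
pose m := (2 * n)%N; pose c : R := m.+1%:R * b ^+ m.+1.
have c1 : 1 <= c by rewrite mulr_ege1 ?exprn_ege1 // ler1n.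
have c0 : 0 <= c := le_trans ler01 c1.
exists (m`!%:R * c ^+ m).
  apply: mulr_gt0; first by rewrite ltr0n fact_gt0.
  by rewrite exprn_gt0 // (lt_le_trans ltr01).
move=> F G coFG /andP[F1 Fn] /andP[G1 Gn].
have F0 : F != 0 by rewrite -size_poly_gt0 ltnW.
have G0 : G != 0 by rewrite -size_poly_gt0 ltnW.
have LF0 : 0 < (zlength F)%:R :> R by rewrite ltr0n zlength_gt0.
have LG0 : 0 < (zlength G)%:R :> R by rewrite ltr0n zlength_gt0.
set theta := _ + _; set LL := _ ^+ _ * _ ^+ _.
have theta0 : 0 <= theta by rewrite addr_ge0 // mulr_ge0 ?invr_ge0.
have [p Ep] : exists p, size F = p.+2 by case: (size F) F1 => [|[|k]] // _; exists k.
have [q Eq] : exists q, size G = q.+2 by case: (size G) G1 => [|[|k]] // _; exists k.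
rewrite Ep in Fn; rewrite Eq in Gn.
pose N := (q + p)%N.
have EN : ((size G).-1 + (size F).-1)%N = N.+2 by rewrite Ep Eq /= addnS.
pose g (i : 'I_N.+2) := Sylvester_row F G i.
have szg i : (size (g i) <= N.+2)%N.
  have Hi' := ltn_ord i; rewrite /N in Hi'.
  rewrite /g /Sylvester_row Eq /N; case: ltnP => Hi.
    apply: leq_trans (zsize_XnM _ _) _; rewrite Ep; clear - Hi Hi'; lia.
  apply: leq_trans (zsize_XnM _ _) _; rewrite Eq; clear - Hi Hi'; lia.
have det0 : \det (\matrix_(i, j) (g i)`_j) != 0.
  exact: (coprimep_det_Sylvester_row EN coFG).
have Nm : (N.+2 <= m)%N by rewrite /m /N; clear - Fn Gn; lia.
have ENq : N.+2 = (q.+1 + p.+1)%N by rewrite addSn addnS.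
apply: le_trans (det_coef_ge1 xi szg det0) _.
pose rho (i : 'I_N.+2) : R :=
  if (i < (size G).-1)%N then c * (zlength F)%:R else c * (zlength G)%:R.
have le_g (i : 'I_N.+2) : c * (zlength (g i))%:R <= rho i.
  by rewrite /rho /g /Sylvester_row; case: ifP => _;
    rewrite ler_wpM2l // ler_nat zlength_XnM.
have le_bc k : (k <= m.+1)%N -> b ^+ k <= c.
  move=> km; apply: le_trans (_ : b ^+ m.+1 <= _); first by rewrite ler_weXn2l.
  by rewrite ler_peMl // ler1n.
have szgm i : (size (g i) <= m.+1)%N := leq_trans (szg i) (leq_trans Nm (leqnSn _)).
apply: le_trans (@norm_det_le R _ _ rho theta _ _) _.
- move=> i j; rewrite mxE; apply: le_trans (le_g i).
  case: ifP => _; last case: ifP => _.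
  + apply: le_trans (norm_zeval_le xi (szgm i)) _.
    by rewrite ler_wpM2r // le_bc.
  + exact: norm_zeval_deriv_le.
  + by apply: le_trans (norm_coef_le_zlength _ _ _) _; rewrite ler_peMl.
- move=> i; rewrite mxE eqxx /rho /g /Sylvester_row.
  have im := ltn_ord i; 
  have iN : (i <= m.+1)%N := leq_trans (ltnW im) (leq_trans Nm (leqnSn _)).
  case: ifP => _.
  + apply: le_trans (norm_zeval_XnM _ (leqnn _)) _.
    rewrite mulrCA; apply: ler_pM => //; first exact: le_bc.
    by rewrite -ler_pdivrMr // lerDl mulr_ge0 ?invr_ge0.
  + apply: le_trans (norm_zeval_XnM _ (leqnn _)) _.
    rewrite mulrCA; apply: ler_pM => //; first exact: le_bc (leq_trans (leq_subr _ _) iN).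
    by rewrite -ler_pdivrMr // lerDr mulr_ge0 ?invr_ge0.
have -> : \prod_i rho i = c ^+ N.+2 * LL.
  rewrite /LL prod_if_ltn ?Ep ?Eq /= ?ENq ?leq_addr // addKn.
  by rewrite [in LHS](exprMn _ c) [in LHS](exprMn _ c) exprD mulrACA.
have LL0 : 0 <= LL by rewrite mulr_ge0 // exprn_ge0 // ltW.
rewrite [theta * (c ^+ _ * _)]mulrCA [leLHS]mulrA ler_wpM2r //; first by rewrite mulr_ge0.
apply: ler_pM; rewrite ?exprn_ge0 // ?ler_nat; first exact: leq_fact.
by rewrite ler_weXn2l.
Qed.

(** Up to a constant, the resultant of [S'] and [d S - (X - c) S'] is the
    discriminant of [S], of degree [2 d - 2] in the coefficients of [S]. Both
    polynomials are combinations of [S] and [S'], so that the minors of the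
    first two columns are Wronskians of such combinations. The choice of [c]
    makes the two polynomials have the same degree. *)
Lemma discriminant_lower_bound (n : nat) : exists2 K : R, 0 < K &
  forall (S : {poly int}) (T : R), coprimep S S^`() ->
    (2 < size S <= n.+1)%N ->
    `|ev S| <= T -> `|ev S^`()| <= T -> `|ev S * ev S^`()^`()| <= T ^+ 2 ->
    1 <= K * (T ^+ 2 * (zlength S)%:R ^+ (2 * (size S - 3))).
Proof.
pose m := (2 * n).+2; pose K0 : R := m%:R * b ^+ m * m%:R.
pose c1 : R := (3 * n.+1)%N%:R.
exists (m`!%:R * (14 * K0 ^+ 2) * c1 ^+ m).
  have b0 : 0 < b := lt_le_trans ltr01 b1.
  have K0_gt0 : 0 < K0.
    by apply: mulr_gt0; [apply: mulr_gt0; [rewrite ltr0n|exact: exprn_gt0]|rewrite ltr0n].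
  apply: mulr_gt0; last by apply: exprn_gt0; rewrite ltr0n.
  apply: mulr_gt0; first by rewrite ltr0n fact_gt0.
  by apply: mulr_gt0; [rewrite ltr0n|exact: exprn_gt0].
move=> S T coS /andP[S2 Sn] leT leT' leT''.
have [p Ep] : exists p, size S = p.+3.
  by case: (size S) S2 => [|[|[|k]]] // _; exists k.
rewrite Ep; rewrite Ep in Sn.
have S0 : S != 0 by rewrite -size_poly_gt0 Ep.
have L1 : 1 <= (zlength S)%:R :> R by rewrite ler1n zlength_gt0.
have lead0 : S`_p.+2 != 0 by rewrite -[p.+2]/(p.+3.-1) -Ep -lead_coefE lead_coef_eq0.
(* The coefficient of X^(p+1) in G below is S`_p.+1 + c * (p+2) * S`_p.+2. *)
pose c : int := (S`_p.+1 == 0)%:R.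
pose D := S^`(); pose V0 := 'X - c%:P : {poly int}.
pose G := p.+2%:Z *: S + - V0 * D.
have szD : size D = p.+2 by rewrite size_deriv Ep.
have coefG j : G`_j.+1 = p.+2%:Z * S`_j.+1 - S`_j.+1 *+ j.+1 + c * (S`_j.+2 *+ j.+2).
  rewrite coefD coefZ mulNr coefN mulrBl coefB coefXM coefCM /= !coef_deriv.
  by rewrite opprB [in RHS]addrAC addrA.
have szG : size G = p.+2.
  apply/eqP; rewrite eqn_leq; apply/andP; split.
    apply/leq_sizeP => -[//|j]; rewrite ltnS => pj; rewrite coefG.
    have -> : S`_j.+2 = 0 by rewrite nth_default // Ep ltnS.
    rewrite mul0rn mulr0 addr0; move: pj; rewrite leq_eqVlt => /predU1P[<-|pj].
      by rewrite -mulr_natl natz subrr.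
    by rewrite nth_default ?Ep // mul0rn mulr0 subrr.
  rewrite ltnNge; apply/negP => /leq_sizeP/(_ p.+1 (leqnn _)).
  rewrite coefG -mulr_natl natz -mulrBl -[p.+2]addn1 PoszD [_ + 1]addrC addrK mul1r.
  rewrite /c; have [->|s0] := eqVneq S`_p.+1 0.
    by rewrite add0r mul1r => /eqP; rewrite mulrn_eq0 /= addn1; apply/negP.
  by rewrite mul0r addr0 => /eqP; apply/negP.
have coDG : coprimep D G.
  rewrite /G addrC coprimep_addl_mul coprimepZr // coprimep_sym.
  exact: coS.
have EN : ((size G).-1 + (size D).-1)%N = (p + p).+2 by rewrite szG szD /= addnS.
pose g (i : 'I_(p + p).+2) := Sylvester_row D G i.
pose kk (i : 'I_(p + p).+2) := if (i < p.+1)%N then (i : nat) else (i - p.+1)%N.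
have le_kk i : (kk i <= p.+1)%N.
  rewrite /kk; case: ifP => [/ltnW //|_].
  by rewrite leq_subLR addSn addnS ltnW.
have szg i : (size (g i) <= (p + p).+2)%N.
  have Hi := ltn_ord i; rewrite /g /Sylvester_row szG /=; case: ltnP => Hi'.
    by apply: leq_trans (zsize_XnM _ _) _; rewrite szD; clear - Hi Hi'; lia.
  by apply: leq_trans (zsize_XnM _ _) _; rewrite szG; clear - Hi Hi'; lia.
pose U (i : 'I_(p + p).+2) : {poly int} :=
  if (i < p.+1)%N then 0 else p.+2%:Z *: 'X^(kk i).
pose V (i : 'I_(p + p).+2) : {poly int} :=
  if (i < p.+1)%N then 'X^(kk i) else - ('X^(kk i) * V0).
have gE i : g i = U i * S + V i * D.
  rewrite /g /U /V /kk /Sylvester_row szG /=; case: ifP => _.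
    by rewrite mul0r add0r.
  by rewrite /G mulrDr -scalerAr -scalerAl mulrA mulrN.
have lenV0 : (zlength V0 <= 2)%N.
  apply: leq_trans (zlengthD _ _) _; rewrite zlengthN zlengthC -['X]expr1 zlength_Xn.
  by rewrite /c; case: eqP.
have szV0 : size V0 = 2 by rewrite size_XsubC.
have pm : (p.+3 < m)%N by rewrite /m; clear - Sn; lia.
have boundK (f : {poly int}) : (size f <= m)%N -> (zlength f <= m)%N ->
    `|ev f| <= K0 /\ `|ev f^`()| <= K0.
  move=> szf lenf; split.
    apply: le_trans (norm_zeval_le xi (leqW szf)) _.
    by rewrite /K0 [leRHS]mulrAC [leRHS]mulrC ler_wpM2l //
      -natrM ler_nat (leq_trans lenf) // leq_pmulr.
  apply: le_trans (norm_zeval_deriv_le szf) _.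
  apply: ler_pM; rewrite ?ler_nat //; exact: mulr_ge0.
have boundU i : `|ev (U i)| <= K0 /\ `|ev (U i)^`()| <= K0.
  apply: boundK; rewrite /U; case: ifP => _; rewrite ?size_poly0 //.
  - apply: leq_trans (size_scale_leq _ _) _; rewrite size_polyXn.
    by apply: leq_ltn_trans (le_kk i) _; apply: ltn_trans pm; rewrite ltnS.
  - by rewrite /zlength size_poly0 big_ord0.
  - by rewrite zlengthZ zlength_Xn muln1; apply: ltnW; apply: ltn_trans pm.
have boundV i : `|ev (V i)| <= K0 /\ `|ev (V i)^`()| <= K0.
  apply: boundK; rewrite /V; case: ifP => _; rewrite ?size_polyN ?zlengthN.
  - rewrite size_polyXn; apply: leq_ltn_trans (le_kk i) _.
    by apply: ltn_trans pm; rewrite ltnS.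
  - apply: leq_trans (zsize_XnM _ _) _; rewrite szV0 addn2.
    apply: (@leq_ltn_trans p.+2); first by rewrite ltnS.
    exact: ltn_trans pm.
  - by rewrite zlength_Xn.
  - by apply: leq_trans (zlength_XnM _ _) _; apply: leq_trans lenV0 _.
have lenD : (zlength D <= n.+1 * zlength S)%N.
  by apply: leq_trans (zlength_deriv _) _; rewrite leq_mul2r Ep Sn orbT.
have len_g i : (zlength (g i))%:R <= c1 * (zlength S)%:R.
  rewrite /c1 -natrM ler_nat /g /Sylvester_row; case: ifP => _.
    apply: leq_trans (zlength_XnM _ _) _; apply: leq_trans lenD _.
    by rewrite leq_mul2r leq_pmull ?orbT.
  apply: leq_trans (zlength_XnM _ _) _; apply: leq_trans (zlengthD _ _) _.
  rewrite zlengthZ mulSn mulnDl leq_add ?leq_mul2r ?(ltnW Sn) ?orbT //.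
  apply: leq_trans (zlengthM _ _) _; rewrite zlengthN -mulnA.
  exact: leq_mul lenV0 lenD.
have det0 : \det (\matrix_(i, j) (g i)`_j) != 0.
  exact: (coprimep_det_Sylvester_row EN coDG).
apply: le_trans (det_coef_ge1 xi szg det0) _.
apply: le_trans (@norm_det_le_minor R _ _ (14 * K0 ^+ 2 * T ^+ 2) (c1 * (zlength S)%:R) _ _) _.
- move=> i k; rewrite !mxE /= !gE !zevalD !derivD !derivM !zevalD !zevalM.
  have [U1 U2] := boundU i; have [V1 V2] := boundV i.
  have [U3 U4] := boundU k; have [V3 V4] := boundV k.
  exact: wronskian_le.
- move=> i j; rewrite mxE /=.
  by apply: le_trans (norm_coef_le_zlength _ _ _) (len_g i).
have T0 : 0 <= T := le_trans (normr_ge0 _) leT.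
have c10 : 1 <= c1 by rewrite /c1 ler1n.
have K00 : 0 <= K0 by apply: mulr_ge0; first exact: mulr_ge0.
have -> : (2 * (p.+3 - 3) = p + p)%N by rewrite !subSS subn0 mul2n addnn.
set LL := _%:R ^+ (p + p); set K1 := 14 * K0 ^+ 2.
have LL0 : 0 <= LL by rewrite exprn_ge0.
have K10 : 0 <= K1 by rewrite mulr_ge0 // exprn_ge0.
have T20 : 0 <= T ^+ 2 by rewrite exprn_ge0.
have Nm : ((p + p).+2 <= m)%N by rewrite /m !ltnS; clear - Sn; lia.
rewrite exprMn -/LL.
have -> : (p + p).+2`!%:R * (K1 * T ^+ 2 * (c1 ^+ (p + p) * LL))
  = (p + p).+2`!%:R * K1 * c1 ^+ (p + p) * (T ^+ 2 * LL) by ring.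
rewrite ler_wpM2r ?mulr_ge0 //.
apply: ler_pM; [exact: mulr_ge0|exact: exprn_ge0 (le_trans ler01 c10)| |].
  by rewrite ler_wpM2r // ler_nat leq_fact.
by rewrite ler_weXn2l // (leq_trans _ Nm) // ltnW.
Qed.

End Resultants.

(** * Minimal polynomials and separation of roots *)

(** The logarithmic derivative is the sum of the [1 / (z - a)], and likewise
    [f'' / f] is a sum of products of two of these; the statement avoids the
    division by [f.[z]]. *)
Lemma deriv_prod_XsubC_le (C : numDomainType) (z delta : C) (rs : seq C) :
  0 <= delta -> (forall a, a \in rs -> delta <= `|z - a|) ->
  let f := \prod_(a <- rs) ('X - a%:P) in
  `|f^`().[z]| * delta <= (size rs)%:R * `|f.[z]| /\
  `|f^`()^`().[z]| * delta ^+ 2 <= (size rs)%:R ^+ 2 * `|f.[z]|.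
Proof.
move=> delta0; elim: rs => [|a rs IHrs] /= le_rs.
  by rewrite big_nil -polyC1 derivC deriv0 horner0 normr0 !mul0r; split;
      rewrite // mulr_ge0 // exprn_ge0.
rewrite big_cons; set g := \prod_(j <- rs) _ in IHrs *.
have [|IH1 IH2] := IHrs; first by move=> c crs; rewrite le_rs // inE crs orbT.
have le_a : delta <= `|z - a| by rewrite le_rs ?mem_head.
rewrite derivM derivXsubC mul1r derivD derivM derivXsubC mul1r.
rewrite !(hornerXsubC, hornerD, hornerM).
set A := z - a in le_a *; set g0 := g.[z] in IH1 IH2 *.
set g1 := g^`().[z] in IH1 IH2 *; set g2 := g^`()^`().[z] in IH2 *.
set k := (size rs)%:R in IH1 IH2 *.
have k0 : 0 <= k by rewrite ler0n.
have H1 : `|g0| * delta <= `|A| * `|g0| by rewrite mulrC ler_wpM2r.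
rewrite -[(size rs).+1%:R]natr1 -/k normrM; split.
  apply: le_trans (ler_wpM2r delta0 (ler_normD _ _)) _.
  rewrite mulrDl normrM -mulrA.
  apply: le_trans (lerD H1 (ler_wpM2l (normr_ge0 _) IH1)) _.
  by rewrite le_eqVlt; apply/orP; left; apply/eqP; ring.
have -> : g1 + (g1 + A * g2) = g1 *+ 2 + A * g2 by rewrite addrA mulr2n.
apply: le_trans (ler_wpM2r (exprn_ge0 2 delta0) (ler_normD _ _)) _.
have H2 : `|g1 *+ 2| * delta ^+ 2 <= (2 * k) * (`|A| * `|g0|).
  have -> : `|g1 *+ 2| * delta ^+ 2 = 2 * (`|g1| * delta * delta).
    by rewrite normrMn; ring.
  have -> : 2 * k * (`|A| * `|g0|) = 2 * (k * (`|A| * `|g0|)) by ring.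
  apply: ler_wpM2l => //; apply: le_trans (ler_wpM2r delta0 IH1) _.
  by rewrite -mulrA ler_wpM2l.
rewrite mulrDl normrM -mulrA.
apply: le_trans (lerD H2 (ler_wpM2l (normr_ge0 _) IH2)) _.
have -> : (k + 1) ^+ 2 * (`|A| * `|g0|) =
  2 * k * (`|A| * `|g0|) + `|A| * (k ^+ 2 * `|g0|) + `|A| * `|g0| by ring.
by rewrite lerDl mulr_ge0.
Qed.

Section AlgebraicNumbers.
Variable R : realType.
Local Notation toC := (real_complex R).

Lemma map_intr_toC (P : {poly int}) :
  map_poly toC (map_poly intr P) = map_poly intr P :> {poly R[i]}.
Proof.
by rewrite -map_poly_comp; apply: eq_map_poly => c /=; rewrite rmorph_int.
Qed.

Lemma horner_toC (P : {poly int}) (xi : R) :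
  (map_poly intr P).[toC xi] = toC (zeval xi P).
Proof. by rewrite -map_intr_toC horner_map. Qed.

Lemma norm_toC (x : R) : `|toC x| = toC `|x|.
Proof. by rewrite normc_def /= expr0n /= addr0 sqrtr_sqr. Qed.

Lemma normC_Re (z : R[i]) : `|z| = toC (complex.Re `|z|).
Proof. by rewrite normc_def. Qed.

Lemma map_intr_neq0 (P : {poly int}) : (map_poly intr P == 0 :> {poly R[i]}) = (P == 0).
Proof.
apply/eqP/eqP => [P0|->]; last by rewrite rmorph0.
by apply: (map_inj_poly (@intr_inj R[i])); rewrite ?mulr0z ?P0 ?rmorph0.
Qed.

(** Pseudo-division of [S] by a polynomial of least degree vanishing at [alpha]
    leaves the remainder [0]. *)
Lemma minpolyZP (S : {poly int}) (alpha : R[i]) :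
  S != 0 -> root (map_poly intr S) alpha ->
  is_minpolyZ alpha (minpolyZ alpha) /\ minpolyZ alpha %| S.
Proof.
move=> S0 rS.
pose p k := `[< exists P : {poly int},
  [/\ P != 0, root (map_poly intr P) alpha & size P = k] >].
have ex_p : exists k, p k by exists (size S); apply/asboolP; exists S.
have [k /asboolP[P [P0 rP szP]] min_k] := ex_minnP ex_p.
have minP (Q : {poly int}) : Q != 0 -> root (map_poly intr Q) alpha -> (size P <= size Q)%N.
  by move=> Q0 rQ; rewrite szP; apply: min_k; apply/asboolP; exists Q.
have isP : is_minpolyZ alpha (zprimitive P).
  split; rewrite ?zprimitive_eq0 ?zcontents_primitive ?P0 ?size_zprimitive //.
  move: rP; rewrite [P in root (map_poly _ P)]zpolyEprim map_polyZ rootZ //=.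
  by rewrite intr_eq0 zcontents_eq0.
have isM : is_minpolyZ alpha (minpolyZ alpha).
  exact: (@xgetPex _ 0 [set Q | is_minpolyZ alpha Q] (ex_intro _ _ isP)).
split=> //; set M := minpolyZ alpha in isM *.
case: isM => M0 rM cM minM.
have [c [q DS]] : exists c q, lead_coef M ^+ c *: S = q * M + (S %% M).
  by exists (scalp S M), (S %/ M); exact: Pdiv.Idomain.divp_eq.
apply/negPn/negP => ndiv.
have r0 : S %% M != 0 by [].
have := minM _ r0; rewrite leqNgt ltn_modp M0 => /(_ _)/negP[] //.
have : root (map_poly intr (lead_coef M ^+ c *: S - q * M)) alpha.
  rewrite rmorphB /= rmorphM map_polyZ rootE hornerD hornerN hornerM hornerZ /=.
  by rewrite (rootP rS) (rootP rM) !mulr0 subrr.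
by rewrite DS [_ + S %% M]addrC addrK.
Qed.

Lemma algebraic_root (S : {poly int}) (alpha : R[i]) :
  S != 0 -> root (map_poly intr S) alpha -> algebraicOver (@ratr R[i]) alpha.
Proof.
move=> S0 rS; exists (map_poly intr S).
  by rewrite map_poly_eq0_id0 // intr_eq0 lead_coef_eq0.
rewrite -map_poly_comp (eq_map_poly (_ : _ =1 intr)) // => c /=.
by rewrite ratr_int.
Qed.

Lemma poly_height_le_zlength (P : {poly int}) : (poly_height P <= zlength P)%N.
Proof. by apply/bigmax_leqP => i _; exact: coef_le_zlength. Qed.

Lemma zlength_le_poly_height n (P : {poly int}) : (size P <= n)%N ->
  (zlength P <= n * poly_height P)%N.
Proof.
move=> szP; rewrite /zlength.
apply: leq_trans (_ : \sum_(i < size P) poly_height P <= _)%N.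
  by apply: leq_sum => i _; exact: (leq_bigmax i).
by rewrite sum_nat_const card_ord leq_mul2r szP orbT.
Qed.

(** The minimal polynomial of a root of [S] divides [S], so that its height is
    controlled by the length of [S]. *)
Lemma alg_height_degree_le n (S : {poly int}) (alpha : R[i]) :
  S != 0 -> (size S <= n.+1)%N -> root (map_poly intr S) alpha ->
  (alg_degree alpha <= n)%N /\ (alg_height alpha <= (2 * n) ^ n * zlength S)%N.
Proof.
move=> S0 szS rS; have [[M0 rM cM _] MS] := minpolyZP S0 rS.
rewrite /alg_degree /alg_height; set M := minpolyZ alpha in M0 rM cM MS *.
have szM : (size M <= size S)%N by exact: zsize_dvd.
split; first by rewrite -ltnS (leq_trans _ szS) // (leq_trans _ szM) // prednK ?size_poly_gt0.
apply: leq_trans (poly_height_le_zlength _) _.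
exact: zlength_dvd.
Qed.

End AlgebraicNumbers.

Lemma size_map_intr (F : numDomainType) (P : {poly int}) :
  size (map_poly intr P : {poly F}) = size P.
Proof. by rewrite size_map_inj_poly ?mulr0z //; exact: intr_inj. Qed.

Section Separation.
Variables (R : realType) (xi : R).
Local Notation toC := (real_complex R).
Local Notation ev := (zeval xi).

Lemma zeval_deriv_le n (S : {poly int}) (delta : R) :
  S != 0 -> (size S <= n.+1)%N -> 0 <= delta ->
  (forall alpha : R[i], root (map_poly intr S) alpha ->
    delta <= complex.Re `|alpha - toC xi|) ->
  `|ev S^`()| * delta <= n%:R * `|ev S| /\
  `|ev S^`()^`()| * delta ^+ 2 <= n%:R ^+ 2 * `|ev S|.
Proof.
move=> S0 szS delta0 sep.
pose f : {poly R[i]} := map_poly intr S.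
have f0 : f != 0 by rewrite map_intr_neq0.
have [rs Df] := closed_field_poly_normal f.
have lead0 : lead_coef f != 0 by rewrite lead_coef_eq0.
have sz_rs : (size rs <= n)%N.
  have : size f = size S := size_map_intr _ S.
  rewrite Df size_scale // size_prod_XsubC => Esz.
  by rewrite -ltnS Esz.
have [||H1 H2] := @deriv_prod_XsubC_le R[i] (toC xi) (toC delta) rs.
- by rewrite ler0c.
- move=> a ars; rewrite distrC normC_Re lecR; apply: sep.
  by rewrite -/f Df rootZ // root_prod_XsubC.
have ders : f^`() = map_poly intr S^`() by rewrite deriv_map.
have ders2 : f^`()^`() = map_poly intr S^`()^`() by rewrite ders deriv_map.
have scale (x y : R[i]) (d c : R[i]) : `|x| * d <= c * `|y| ->
    `|lead_coef f * x| * d <= c * `|lead_coef f * y|.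
  by move=> xy; rewrite !normrM [leRHS]mulrCA -mulrA ler_wpM2l.
have E0 : toC (ev S) = lead_coef f * (\prod_(a <- rs) ('X - a%:P)).[toC xi].
  by rewrite -horner_toC -/f {1}Df hornerZ.
have E1 : toC (ev S^`()) = lead_coef f * (\prod_(a <- rs) ('X - a%:P))^`().[toC xi].
  by rewrite -horner_toC -ders {1}Df derivZ hornerZ.
have E2 : toC (ev S^`()^`()) = lead_coef f * (\prod_(a <- rs) ('X - a%:P))^`()^`().[toC xi].
  by rewrite -horner_toC -ders2 {1}Df !derivZ hornerZ.
have le_n : (size rs)%:R <= n%:R :> R by rewrite ler_nat.
have En : (size rs)%:R = toC (size rs)%:R by rewrite rmorph_nat.
have EnX : (size rs)%:R ^+ 2 = toC ((size rs)%:R ^+ 2) by rewrite En rmorphXn.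
have EdX : toC delta ^+ 2 = toC (delta ^+ 2) by rewrite rmorphXn.
have := scale _ _ _ _ H1; rewrite -E0 -E1 !norm_toC En -2!rmorphM /= lecR => {}H1.
have := scale _ _ _ _ H2; rewrite -E0 -E2 !norm_toC EnX EdX -2!rmorphM /= lecR => {}H2.
split; first by apply: le_trans H1 _; rewrite ler_wpM2r.
by apply: le_trans H2 _; rewrite ler_wpM2r // lerXn2r ?nnegrE.
Qed.

(** If every root [alpha] has [H(alpha) |xi - alpha| >= v], the derivatives of
    [S] at [xi] are controlled by its value, and the lower bound for the
    discriminant becomes one for [|S(xi)|]. In degree [1], it is the length of
    [S] that is controlled by the leading coefficient and the value. *)
Lemma squarefree_lower_bound (n : nat) : exists2 K : R, 0 < K &
  forall (S : {poly int}) (v : R), coprimep S S^`() ->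
    (1 < size S <= n.+1)%N -> 0 < v <= 1 ->
    (forall alpha : R[i], root (map_poly intr S) alpha -> v <= alg_dist xi alpha) ->
    v <= K * (`|ev S| * (zlength S)%:R ^+ (size S - 2)).
Proof.
have [K K0 discr] := discriminant_lower_bound xi n.
pose c : R := ((2 * n) ^ n)%N%:R.
exists ((2 + `|xi| + K) * (n%:R * c) + 1).
  by rewrite ltr_wpDl // mulr_ge0 ?mulr_ge0 // addr_ge0 ?addr_ge0 // ltW.
move=> S v coS /andP[S1 Sn] /andP[v0 v1] sep.
have S0 : S != 0 by rewrite -size_poly_gt0 ltnW.
have n1 : (0 < n)%N by rewrite -ltnS (leq_trans S1).
have c1 : 1 <= c by rewrite /c ler1n expn_gt0 muln_gt0 n1.
set L : R := (zlength S)%:R.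
have L1 : 1 <= L by rewrite /L ler1n zlength_gt0.
have c0 : 0 <= c := le_trans ler01 c1.
have L0 : 0 <= L := le_trans ler01 L1.
have cL1 : 1 <= c * L by rewrite mulr_ege1.
have cL0 : 0 < c * L := lt_le_trans ltr01 cL1.
pose delta := v / (c * L).
have delta0 : 0 < delta by rewrite divr_gt0.
have [||H1 H2] := @zeval_deriv_le n S delta S0 Sn.
- exact: ltW.
- move=> alpha ra; have := sep _ ra; rewrite /alg_dist => le_v.
  have [_ Hle] := alg_height_degree_le S0 Sn ra.
  rewrite /delta ler_pdivrMr // mulrC; apply: le_trans le_v _.
  rewrite ler_wpM2r //; last by rewrite /c /L -natrM ler_nat.
  by rewrite -ler0c -normC_Re.
pose T := n%:R * `|ev S| * (c * L / v).
have leT' : `|ev S^`()| <= T.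
  by rewrite /T -[c * L / v]invf_div -/delta ler_pdivlMr.
have n1R : 1 <= n%:R :> R by rewrite ler1n.
have leT : `|ev S| <= T.
  have : 1 * `|ev S| * 1 <= T.
    apply: ler_pM; rewrite ?mulr_ge0 //; first exact: ler_wpM2r.
    by rewrite ler_pdivlMr // mul1r (le_trans v1).
  by rewrite mul1r mulr1.
have leT'' : `|ev S * ev S^`()^`()| <= T ^+ 2.
  have -> : T ^+ 2 = `|ev S| * (n%:R ^+ 2 * `|ev S| * (c * L / v) ^+ 2) by rewrite /T; ring.
  rewrite normrM ler_wpM2l // -[c * L / v]invf_div -/delta exprVn.
  by rewrite ler_pdivlMr // exprn_gt0.
have T0 : 0 <= T := le_trans (normr_ge0 _) leT.
have [S2|S2] := ltnP 2 (size S).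
  have := discr S T coS; rewrite S2 Sn => /(_ isT leT leT' leT'') le1.
  set d := (size S - 3)%N in le1 *.
  have Ed : (size S - 2 = d.+1)%N.
    by rewrite /d; case: (size S) S2 => [|[|[|k]]] // _; rewrite !subSS !subn0.
  rewrite Ed; set E := `|ev S|.
  set M := n%:R * c * (E * L ^+ d.+1).
  have M0 : 0 <= M.
    by apply: mulr_ge0; [exact: mulr_ge0|apply: mulr_ge0; [exact: normr_ge0|exact: exprn_ge0]].
  have v2 : v ^+ 2 <= K * M ^+ 2.
    have -> : K * M ^+ 2 = v ^+ 2 * (K * (T ^+ 2 * L ^+ (2 * d))).
      rewrite /M /T -/E (mulnC 2 d) (exprM L) (exprS L d); field.
      by rewrite gt_eqF.
    by rewrite ler_peMr // exprn_ge0 // ltW.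
  have le_vM : v <= (1 + K) * M.
    have K1 : 0 <= 1 + K by rewrite addr_ge0 // ltW.
    rewrite -ler_sqr ?nnegrE; [|exact: ltW|exact: mulr_ge0].
    have -> : ((1 + K) * M) ^+ 2 = (1 + K) ^+ 2 * M ^+ 2 by ring.
    apply: le_trans v2 _; rewrite ler_wpM2r ?exprn_ge0 //.
    by have := ltW K0; nra.
  apply: le_trans le_vM _; rewrite /M mulrA ler_wpM2r //.
    by apply: mulr_ge0; [exact: normr_ge0|exact: exprn_ge0].
  have : 0 <= (1 + `|xi|) * (n%:R * c) by apply: mulr_ge0; apply: addr_ge0 || exact: mulr_ge0.
  lra.
have szS : size S = 2 by apply/eqP; rewrite eqn_leq S2.
rewrite szS subnn expr0 mulr1.
have LE : L <= (2 + `|xi|) * T.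
  have ES : ev S = (S`_0)%:~R + (S`_1)%:~R * xi.
    rewrite /zeval (@horner_coef_wide _ 2) ?big_ord_recl ?big_ord0 ?addr0 /=.
      by rewrite !coef_map /= expr0 expr1 mulr1.
    by rewrite size_map_intr szS.
  have ES' : ev S^`() = (S`_1)%:~R.
    rewrite /zeval (@horner_coef_wide _ 1) ?big_ord_recl ?big_ord0 ?addr0 /=.
      by rewrite coef_map coef_deriv /= expr0 mulr1.
    by rewrite size_map_intr; have := lt_size_deriv S0; rewrite szS.
  have LE : L = `|(S`_0)%:~R| + `|(S`_1)%:~R|.
    by rewrite /L /zlength szS !big_ord_recl big_ord0 addn0 natrD !natr_absz !intr_norm.
  have S0E : (S`_0)%:~R = ev S - ev S^`() * xi :> R by rewrite ES ES' addrK.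
  rewrite LE S0E -ES'; apply: le_trans (lerD (ler_normB _ _) (lexx _)) _.
  rewrite normrM; have := ler_wpM2r (normr_ge0 xi) leT'; nra.
have nc0 : 0 <= n%:R * c by rewrite mulr_ge0.
have : v * L <= ((2 + `|xi|) * (n%:R * c) * `|ev S|) * L.
  have -> : (2 + `|xi|) * (n%:R * c) * `|ev S| * L = v * ((2 + `|xi|) * T).
    by rewrite /T; field; rewrite gt_eqF.
  by rewrite ler_wpM2l // ltW.
rewrite ler_pM2r ?(lt_le_trans ltr01) // => le_v.
apply: le_trans le_v _; rewrite ler_wpM2r //.
have : 0 <= K * (n%:R * c) by rewrite mulr_ge0 // ltW.
lra.
Qed.

End Separation.

Local Open Scope classical_set_scope.

(** * Finiteness, and the two exponents at a given height *)

Lemma finite_polyZ (n B : nat) : finite_set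
  [set P : {poly int} | (size P <= n)%N /\ forall i, (absz (P`_i)%R <= B)%N].
Proof.
pose F (f : {ffun 'I_n -> 'I_(2 * B).+1}) : {poly int} :=
  \sum_(i < n) ((f i)%:Z - B%:Z) *: 'X^i.
apply: (@sub_finite_set _ _ [set` [seq F f | f <- enum {ffun 'I_n -> 'I_(2 * B).+1}]]).
  move=> P /= [szP leB].
  have shift (z : int) : (absz z <= B)%N ->
      (absz (z + B%:Z)%R <= 2 * B)%N /\ (absz (z + B%:Z)%R)%:Z - B%:Z = z by lia.
  pose f := [ffun i : 'I_n => inord (absz ((P`_i + B%:Z)%R)) : 'I_(2 * B).+1].
  suff -> : P = F f by apply: map_f; rewrite mem_enum.
  rewrite /F; transitivity (\sum_(i < n) P`_i *: 'X^i).
    rewrite -poly_def; apply/polyP => j; rewrite coef_poly.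
    by case: ltnP => // /(leq_trans szP) le_j; rewrite nth_default.
  apply: eq_bigr => i _; congr (_ *: _); have [lez ez] := shift _ (leB i).
  by rewrite ffunE inordK ?ltnS ?ez.
by apply/finite_seqP; eexists.
Qed.

Lemma argmin_exists (R : realType) (T : choiceType) (A : set T) (f : T -> R) :
  finite_set A -> A !=set0 -> exists x, argmin_on A f x.
Proof.
move=> /finite_seqP[s ->]; elim: s => [|a s IHs] [x0 xs //].
have [[x [xs' minx]]|no] := pselect (exists x, argmin_on [set` s] f x).
  have [le_ax|le_xa] := leP (f a) (f x).
    exists a; split=> [|y] /=; first by rewrite mem_head.
    rewrite inE => /predU1P[->//|ys]; apply: le_trans le_ax _; exact: minx.
  exists x; split=> [|y] /=; first by rewrite inE xs' orbT.
  rewrite inE => /predU1P[->|ys]; [exact: ltW|exact: minx].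
have s0 : s = [::].
  by case: s IHs no {xs} => // b s IHs []; apply: IHs; exists b; rewrite /= mem_head.
exists a; split=> [|y] /=; first by rewrite mem_head.
by rewrite s0 inE => /eqP->.
Qed.

Lemma algebraicOver_polyZ (F : numFieldType) (x : F) :
  algebraicOver (@ratr F) x ->
  exists2 P : {poly int}, P != 0 & root (map_poly intr P) x.
Proof.
case=> p p0 rp; have [q [a a0 Dp]] := rat_poly_scale p.
exists q; first by apply: contraNneq p0 => q0; rewrite Dp q0 rmorph0 scaler0.
move: rp; rewrite Dp map_polyZ rootZ; last first.
  by rewrite fmorph_eq0 invr_eq0 intr_eq0.
rewrite -map_poly_comp (eq_map_poly (_ : _ =1 intr)) // => c /=.
by rewrite ratr_int.
Qed.

Lemma zeval_neq0 (R : realType) (xi : R) (P : {poly int}) :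
  transcendental xi -> P != 0 -> zeval xi P != 0.
Proof.
move=> tr P0; apply/negP => rP; apply: tr; exists (map_poly intr P).
  by rewrite map_poly_eq0_id0 // intr_eq0 lead_coef_eq0.
rewrite -map_poly_comp (eq_map_poly (_ : _ =1 intr)); first exact: rP.
by move=> c /=; rewrite ratr_int.
Qed.

(** A minimum over a finite set of non-zero values. *)
Lemma zeval_bounded_below (R : realType) (xi : R) (n B : nat) :
  transcendental xi -> exists2 c : R, 0 < c &
  forall P : {poly int}, P != 0 -> (size P <= n)%N -> (zlength P <= B)%N ->
    c <= `|zeval xi P|.
Proof.
move=> tr; pose A := [set P : {poly int} | [/\ P != 0, (size P <= n)%N & (zlength P <= B)%N]].
have finA : finite_set A.
  apply: sub_finite_set (finite_polyZ n B) => P [_ szP lenP]; split=> // i.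
  exact: leq_trans (coef_le_zlength P i) lenP.
have [A0|noA] := pselect (A !=set0); last first.
  by exists 1 => // P P0 szP lenP; case: noA; exists P.
have [P [[P0 _ _] minP]] := argmin_exists (fun P => `|zeval xi P|) finA A0.
exists `|zeval xi P|; first by rewrite normr_gt0 zeval_neq0.
by move=> Q Q0 szQ lenQ; apply: minP.
Qed.

Lemma coef_le_poly_height (P : {poly int}) i : (absz (P`_i)%R <= poly_height P)%N.
Proof.
have [le_Pi|lt_iP] := leqP (size P) i; first by rewrite nth_default.
exact: (@leq_bigmax _ (fun i : 'I_(size P) => absz (P`_i)%R) (Ordinal lt_iP)).
Qed.

Section Exponents.
Variables (R : realType) (n : nat) (xi : R).

(** These numbers are roots of their minimal polynomials, of which there are
    finitely many. *)
Lemma finite_algs_upto (X : R) : finite_set (algs_upto n X).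
Proof.
pose B := (Num.trunc X).+1.
have [s Es] := iffLR (finite_seqP _) (finite_polyZ n.+1 B).
pose roots (P : {poly int}) := sval (closed_field_poly_normal (map_poly intr P : {poly R[i]})).
apply: (@sub_finite_set _ _ [set` flatten [seq roots P | P <- s]]); last first.
  by apply/finite_seqP; eexists.
move=> alpha [/algebraicOver_polyZ[P P0 rP] deg_a ht_a] /=.
have [[M0 rM _ _] _] := minpolyZP P0 rP; set M := minpolyZ alpha in M0 rM.
apply/flatten_mapP; exists M.
  have : [set P : {poly int} | (size P <= n.+1)%N /\ forall i, (absz (P`_i)%R <= B)%N] M.
    split; first by move: deg_a; rewrite /alg_degree -/M; case: (size M).
    move=> i; apply: leq_trans (coef_le_poly_height M i) _.
    rewrite -(ler_nat R); apply: (le_trans ht_a); apply: ltW.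
    by have /andP[] := truncn_itv (le_trans (ler0n _ _) ht_a).
  by rewrite Es.
rewrite /roots; case: closed_field_poly_normal => /= rs Dp.
have lead0 : lead_coef (map_poly intr M : {poly R[i]}) != 0.
  by rewrite lead_coef_eq0 map_intr_neq0.
by move: rM; rewrite Dp rootZ // root_prod_XsubC.
Qed.

Lemma limf_einf_gt (f : R -> R) (a : R) :
  (a%:E < limf_einf (fun X => (f X)%:E) (pinfty_nbhs R))%E ->
  exists M : R, forall X, M < X -> a < f X.
Proof.
rewrite limf_einfE => /ereal_sup_gt[_ [V [M [_ MV]] <-]] lt_a.
exists M => X MX; rewrite -lte_fin; apply: lt_le_trans lt_a _.
by apply: ereal_inf_lbound; exists X => //; exact: MV.
Qed.

Lemma limf_einf_lt (f : R -> R) (a : R) :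
  (limf_einf (fun X => (f X)%:E) (pinfty_nbhs R) < a%:E)%E ->
  forall M : R, exists2 X, M < X & f X < a.
Proof.
move=> lt_a M; apply: contrapT => no.
move: lt_a; rewrite ltNge => /negP; apply; rewrite limf_einfE.
apply: (@le_trans _ _ (ereal_inf [set (f X)%:E | X in [set X | M < X]])); last first.
  apply: ereal_sup_ubound; exists [set X | M < X]; last by [].
  by exists M; split; rewrite ?num_real.
apply: le_ereal_inf_tmp => _ [X MX <-]; rewrite lee_fin leNgt; apply/negP => lt_X.
by apply: no; exists X.
Qed.

Lemma w_gt_best (omega X : R) : 0 < omega -> 1 < X -> omega < w n xi X ->
  exists2 P, polys_upto n X P & `|zeval xi P| <= X `^ (- omega).
Proof.
move=> omega0 X1; rewrite /w; set P := best_poly n xi X; set d := poly_dist xi P.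
have lnX : 0 < ln X by rewrite ln_gt0.
rewrite ltrNr ltr_pdivrMr // => lt_d.
have d0 : 0 < d.
  rewrite ltNge; apply/negP => /ln0 d0; move: lt_d; rewrite d0 ltNge => /negP; apply.
  by rewrite mulNr oppr_le0; apply: mulr_ge0; exact: ltW.
have : argmin_on (polys_upto n X) (poly_dist xi) P.
  (* If there were no minimizer, the default value 0 would give w = 0. *)
  have [ex|no] := pselect (exists Q, argmin_on (polys_upto n X) (poly_dist xi) Q).
    exact: xgetPex.
  have P0 : P = 0 by apply: xgetPN => Q inQ; apply: no; exists Q.
  by move: d0; rewrite /d P0 /poly_dist rmorph0 horner0 normr0 ltxx.
move=> [inP _]; exists P => //; rewrite -[leLHS]/d.
rewrite -ler_ln ?posrE // ?ln_powR; first exact: ltW.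
by rewrite powR_gt0 // (lt_trans ltr01).
Qed.

Lemma alg_dist_gt0 (alpha : R[i]) : transcendental xi ->
  algebraicOver (@ratr R[i]) alpha -> 0 < alg_dist xi alpha.
Proof.
move=> tr /algebraicOver_polyZ[P P0 rP]; have [[M0 rM cM _] _] := minpolyZP P0 rP.
have ht0 : (0 < alg_height alpha)%N.
  rewrite /alg_height; set M := minpolyZ alpha in M0 *.
  apply: leq_trans (coef_le_poly_height M (size M).-1); rewrite absz_gt0.
  by rewrite -lead_coefE lead_coef_eq0.
rewrite /alg_dist mulr_gt0 ?ltr0n //.
rewrite -ltcR -normC_Re normr_gt0 subr_eq0; apply/eqP => Ea.
have E : real_complex R (zeval xi P) = real_complex R 0.
  by rewrite -horner_toC -Ea (rootP rP).
by have := zeval_neq0 tr P0; rewrite (complexI E) eqxx.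
Qed.

Lemma wstar_lt_alg_dist (s X : R) : transcendental xi -> 1 < X ->
  wstar n xi X < s ->
  forall alpha, algs_upto n X alpha -> X `^ (- s) <= alg_dist xi alpha.
Proof.
move=> tr X1; rewrite /wstar; set beta := best_alg n xi X => lt_s alpha in_a.
have lnX : 0 < ln X by rewrite ln_gt0.
have [in_b min_b] : argmin_on (algs_upto n X) (alg_dist xi) beta.
  apply: xgetPex; apply: argmin_exists; first exact: finite_algs_upto.
  by exists alpha.
apply: le_trans (min_b _ in_a); move: lt_s; rewrite ltrNl ltr_pdivlMr // => lt_s.
have b0 : 0 < alg_dist xi beta by case: in_b => alg_b _ _; apply: alg_dist_gt0.
have X0 : 0 < X := lt_trans ltr01 X1.
by rewrite -ler_ln ?posrE ?powR_gt0 // ln_powR; exact: ltW.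
Qed.

End Exponents.

(** * Rational and low-degree approximation *)

Section LowerBounds.
Variables (R : realType) (xi : R).
Local Notation ev := (zeval xi).
Local Notation toC := (real_complex R).

(** Two of the [N + 1] fractional parts of the numbers [i * xi] lie in the same
    of [N] cells of length [1 / N]. *)
Lemma dirichlet (N : nat) : (0 < N)%N -> exists (q : nat) (p : int),
  (0 < q <= N)%N /\ `|q%:R * xi - p%:~R| <= N%:R^-1.
Proof.
move=> N0; pose frac (i : nat) := i%:R * xi - (Num.floor (i%:R * xi))%:~R.
have N0R : 0 < N%:R :> R by rewrite ltr0n.
have frac_itv i : 0 <= frac i < 1.
  have := floor_itv (i%:R * xi); rewrite intrD => /andP[lo hi].
  by rewrite /frac subr_ge0 lo ltrBlDl.
have lt_cell (i : 'I_N.+1) : (Num.trunc (N%:R * frac i) < N)%N.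
  have /andP[f0 f1] := frac_itv i.
  have Nf0 : 0 <= N%:R * frac i by rewrite mulr_ge0.
  rewrite -(ltr_nat R); have /andP[le_t _] := truncn_itv Nf0.
  apply: le_lt_trans le_t _; rewrite -[ltRHS]mulr1; by rewrite ltr_pM2l.
pose cell (i : 'I_N.+1) : 'I_N := Ordinal (lt_cell i).
have : ~~ injectiveb cell.
  by apply/injectiveP => /leq_card; rewrite !card_ord ltnn.
case/injectivePn => i [j ne_ij /(congr1 val) /= eq_cell].
wlog lt_ij : i j ne_ij eq_cell / (i < j)%N.
  move=> H; have := ne_ij; rewrite neq_ltn => /orP[|lt_ji]; first exact: H ne_ij eq_cell.
  by apply: (H j i); rewrite // eq_sym.
have /andP[fi0 _] := frac_itv i; have /andP[fj0 _] := frac_itv j.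
exists (j - i)%N, (Num.floor (j%:R * xi) - Num.floor (i%:R * xi)); split.
  by rewrite subn_gt0 lt_ij -ltnS (leq_ltn_trans (leq_subr _ _)).
have -> : (j - i)%:R * xi - (Num.floor (j%:R * xi) - Num.floor (i%:R * xi))%:~R
  = frac j - frac i.
  by rewrite /frac natrB ?(ltnW lt_ij) // intrB; ring.
have /andP[li ui] := truncn_itv (mulr_ge0 (ltW N0R) fi0).
have /andP[lj uj] := truncn_itv (mulr_ge0 (ltW N0R) fj0).
rewrite eq_cell -natr1 in li ui; rewrite -natr1 in uj.
rewrite -[leRHS]mul1r ler_pdivlMr // -[N%:R]gtr0_norm // -normrM mulrBl.
rewrite ler_norml; apply/andP; split; rewrite ![_ * N%:R]mulrC; lra.
Qed.

Lemma alg_dist_dirichlet (n : nat) : (0 < n)%N -> exists C X0 : R,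
  forall X, X0 < X -> exists2 alpha, algs_upto n X alpha & alg_dist xi alpha <= C / X.
Proof.
move=> n0; pose c := 2 * (2 + `|xi|); exists (2 * c ^+ 2), c => X ltX.
have c0 : 0 < c by rewrite /c mulr_gt0 // addr_gt0_ge0.
have X0 : 0 < X := lt_trans c0 ltX.
pose N := Num.trunc (X / c).
have Xc1 : 1 < X / c by rewrite ltr_pdivlMr // mul1r.
have /andP[leN ltN] := truncn_itv (ltW (lt_trans ltr01 Xc1)).
have N0 : (0 < N)%N.
  by rewrite lt0n; apply/negP => /eqP EN; move: ltN; rewrite -/N EN; lra.
have [q [p [/andP[q0 qN] le_pq]]] := dirichlet N0.
have q0R : 0 < q%:R :> R by rewrite ltr0n.
have qn0 : q%:R != 0 :> R by rewrite gt_eqF.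
pose S : {poly int} := q%:Z *: 'X + (- p)%:P.
have szS : size S = 2.
  have szqX : size (q%:Z *: 'X : {poly int}) = 2.
    by rewrite size_scale ?size_polyX // eqz_nat -lt0n.
  by rewrite /S size_polyDl szqX // size_polyC; case: eqP.
have S0 : S != 0 by rewrite -size_poly_gt0 szS.
pose alpha : R[i] := toC (p%:~R / q%:R).
have ra : root (map_poly intr S) alpha.
  rewrite rootE horner_toC /zeval /S rmorphD /= map_polyZ map_polyX map_polyC /=.
  rewrite hornerD hornerZ hornerX hornerC mulrNz mulrCA divff //.
  by rewrite mulr1 subrr.
have [deg_a ht_a] := alg_height_degree_le S0 (n := 1) (eq_leq szS) ra.
rewrite expn1 muln1 in ht_a.
have lenS : (zlength S)%:R <= q%:R * (2 + `|xi|).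
  apply: le_trans (_ : q%:R + `|p%:~R| <= _).
    rewrite -intr_norm -[X in _ + X]natr_absz -natrD ler_nat.
    apply: leq_trans (zlengthD _ _) _.
    by rewrite zlengthZ zlengthC abszN -['X]expr1 zlength_Xn muln1.
  have : `|p%:~R| <= `|q%:R * xi| + `|q%:R * xi - p%:~R|.
    by rewrite -[X in `|X| <= _](subKr (q%:R * xi)); apply: ler_normB.
  rewrite normrM normr_nat.
  have : N%:R^-1 <= q%:R :> R.
    apply: le_trans (_ : 1 <= _); last by rewrite ler1n.
    by rewrite invf_le1 ?ler1n ?ltr0n.
  lra.
have ht_le : (alg_height alpha)%:R <= q%:R * c.
  apply: le_trans (_ : (2 * zlength S)%:R <= _); first by rewrite ler_nat.
  by rewrite natrM /c; lra.
exists alpha.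
  split; [exact: algebraic_root S0 ra|exact: leq_trans deg_a n0|].
  apply: le_trans ht_le _; rewrite -ler_pdivlMr //; apply: le_trans leN.
  by rewrite ler_nat.
have -> : alg_dist xi alpha = (alg_height alpha)%:R * `|p%:~R / q%:R - xi|.
  by rewrite /alg_dist /alpha -rmorphB norm_toC.
apply: le_trans (_ : c / N%:R <= _).
  apply: le_trans (ler_wpM2r (normr_ge0 _) ht_le) _.
  have E : q%:R * `|p%:~R / q%:R - xi| = `|q%:R * xi - p%:~R|.
    by rewrite -{1}[q%:R]gtr0_norm // -normrM mulrBr mulrCA divff // mulr1 distrC.
  by rewrite mulrAC E mulrC ler_wpM2l // ltW.
rewrite ler_pdivrMr ?ltr0n // mulrAC ler_pdivlMr //.
have : X <= 2 * c * N%:R.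
  have : X < c * N.+1%:R by rewrite mulrC -ltr_pdivrMr.
  have : 1 <= N%:R :> R by rewrite ler1n.
  by rewrite -natr1; nra.
by rewrite expr2; nra.
Qed.

Lemma powR_unbounded (a C : R) : 0 < a -> exists2 M : R, 1 <= M &
  forall X, M < X -> C < X `^ a.
Proof.
move=> a0; pose B := 1 + `|C|; have B1 : 1 <= B by rewrite lerDl.
have B0 : 0 < B := lt_le_trans ltr01 B1.
exists (1 + B `^ a^-1); first by rewrite lerDl powR_ge0.
move=> X ltX; apply: le_lt_trans (_ : B < _); first by rewrite /B; have := ler_norm C; lra.
have -> : B = (B `^ a^-1) `^ a by rewrite -powRrM mulVf ?gt_eqF // powRr1 // ltW.
apply: gt0_ltr_powR => //; rewrite ?nnegrE ?powR_ge0 //.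
  by apply: ltW; apply: le_lt_trans ltX; rewrite addr_ge0 // powR_ge0.
by apply: le_lt_trans ltX; rewrite lerDr.
Qed.

(** Rational numbers alone give [H(alpha) |xi - alpha| << 1 / X]. *)
Lemma exponent_ge1 (n : nat) (s : R) : (0 < n)%N ->
  (forall M : R, exists2 X, M < X &
    forall alpha, algs_upto n X alpha -> X `^ (- s) <= alg_dist xi alpha) ->
  1 <= s.
Proof.
move=> n0 freq; rewrite leNgt; apply/negP => s1.
have [C [X0 small]] := alg_dist_dirichlet n0.
have a0 : 0 < 1 - s by rewrite subr_gt0.
have [M M1 big] := powR_unbounded C a0.
have [X ltX far] := freq (Num.max M X0).
move: ltX; rewrite gt_max => /andP[MX X0X].
have Xgt0 : 0 < X by apply: lt_trans MX; apply: lt_le_trans M1.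
have [alpha in_a le_a] := small X X0X.
have := le_trans (far _ in_a) le_a; rewrite leNgt => /negP; apply.
rewrite ltr_pdivrMr // -[X in _ * X]powRr1 ?(ltW Xgt0) // -powRD ?(gt_eqF Xgt0) ?implybT //.
by rewrite addrC; exact: big.
Qed.

End LowerBounds.

Section Bounds.
Variables (R : realType) (xi : R).
Local Notation ev := (zeval xi).

Lemma nonconstant_of_small (P : {poly int}) : P != 0 -> `|ev P| < 1 -> (1 < size P)%N.
Proof.
move=> P0; rewrite ltnNge; apply: contraL => szP; rewrite -leNgt.
have EP := size1_polyC szP; rewrite EP /zeval map_polyC hornerC /=.
rewrite -intr_norm -abszE ler1n absz_gt0.
by apply: contraNneq P0 => c0; rewrite EP c0.
Qed.

(** Let [P] be a good approximation of height slightly below that of [Q]. Then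
    [Q] does not divide [P], so that their resultant is at least [1] in absolute
    value; the contribution of [P(xi)] to it is negligible when
    [omega > n + m - 1]. The finitely many [Q] of small length are dealt with by
    decreasing [c]. *)
Lemma irreducible_lower_bound (n m : nat) (omega : R) :
  transcendental xi -> (0 < m <= n)%N -> (n + m)%:R - 1 < omega ->
  (exists M : R, forall X, M < X ->
    exists2 P, polys_upto n X P & `|ev P| <= X `^ (- omega)) ->
  exists2 c : R, 0 < c & forall Q : {poly int}, irreducible_poly Q ->
    zcontents Q = 1 -> size Q = m.+1 ->
    c <= `|ev Q| * (zlength Q)%:R ^+ (n + m).-1.
Proof.
move=> tr /andP[m0 mn] lt_omega [M0 approx].
have n0 : (0 < n)%N := leq_trans m0 mn.
have [K K0 res] := resultant_lower_bound xi n.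
(* The factor by which the height of P must be smaller to exclude Q %| P. *)
pose c1 : nat := ((2 * n) ^ n * n.+1).+1.
have c10 : 0 < c1%:R :> R by rewrite ltr0n.
set E := (n + m).-1.
have EE : E%:R = (n + m)%:R - 1 :> R.
  by rewrite /E -subn1 natrB // addn_gt0 n0.
have a0 : 0 < omega - E%:R by rewrite subr_gt0 EE.
have [M1 M11 big] := powR_unbounded (2 * K * c1%:R ^+ E) a0.
pose G0 := Num.max M0 M1.
pose B := (Num.trunc (c1%:R * G0)).+1.
have [c' c'0 below] := zeval_bounded_below n.+1 B tr.
have KV0 : 0 < (2 * K)^-1 by rewrite invr_gt0 mulr_gt0.
exists (Num.min c' (2 * K)^-1); first by rewrite lt_min c'0.
move=> Q irrQ cQ szQ; have Q0 := irredp_neq0 irrQ.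
set LQ : R := (zlength Q)%:R.
have LQ1 : 1 <= LQ by rewrite /LQ ler1n zlength_gt0.
have LQ0 : 0 < LQ := lt_le_trans ltr01 LQ1.
have [G LG] : exists G : R, LQ = c1%:R * G.
  by exists (LQ / c1%:R); rewrite mulrC divfK // gt_eqF.
have [le_G|lt_G] := leP G G0.
  rewrite ge_min; apply/orP; left.
  apply: le_trans (below Q Q0 _ _) _; first by rewrite szQ ltnS.
    have le_LQ : LQ <= c1%:R * G0 by rewrite LG ler_pM2l.
    rewrite -(ler_nat R); apply: (le_trans le_LQ); apply: ltW.
    have pos : 0 <= c1%:R * G0 by apply: le_trans (ltW LQ0) le_LQ.
    by have /andP[] := truncn_itv pos.
  by rewrite ler_peMr // exprn_ege1.
rewrite ge_min; apply/orP; right.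
move: lt_G; rewrite gt_max => /andP[M0G M1G].
have G1 : 1 < G := le_lt_trans M11 M1G.
have Ggt0 : 0 < G := lt_trans ltr01 G1.
have [P [P0 szP htP] smallP] := approx _ M0G.
have eG : G `^ (- omega) = (G `^ omega)^-1 by rewrite powRN.
have Gom : 0 < G `^ omega by rewrite powR_gt0.
have GE : 0 < G ^+ E by rewrite exprn_gt0.
have Gsplit : G `^ omega = G `^ (omega - E%:R) * G ^+ E.
  rewrite -powR_mulrn ?(ltW Ggt0) // -powRD ?subrK //.
  by rewrite (gt_eqF Ggt0) implybT.
have omega0 : 0 < omega.
  by apply: le_lt_trans lt_omega; rewrite -EE.
have smallP1 : `|ev P| < 1.
  apply: le_lt_trans smallP _; rewrite eG invf_lt1 //.
  rewrite (_ : 1 = 1 `^ omega); last by rewrite powR1.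
  apply: gt0_ltr_powR => //; rewrite nnegrE //.
  exact: ltW.
have szP1 := nonconstant_of_small P0 smallP1.
have lenP : (zlength P)%:R <= n.+1%:R * G.
  apply: le_trans (_ : (n.+1 * poly_height P)%N%:R <= _).
    by rewrite ler_nat zlength_le_poly_height.
  by rewrite natrM ler_wpM2l.
have ndiv : ~~ (Q %| P).
  apply/negP => /(zlength_dvd P0 szP cQ); rewrite -(ler_nat R) natrM -/LQ.
  rewrite leNgt => /negP; apply.
  apply: le_lt_trans (ler_wpM2l (ler0n _ _) lenP) _.
  by rewrite LG mulrA ltr_pM2r // -natrM ltr_nat.
have co := irreducible_coprimep irrQ ndiv.
have := res Q P co; rewrite szQ !ltnS m0 mn szP1 szP => /(_ isT isT).
rewrite -/LQ succnK; set LP : R := (zlength P)%:R; set e := (size P).-1.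
have LP1 : 1 <= LP by rewrite /LP ler1n zlength_gt0.
have LPQ : LP <= LQ.
  apply: le_trans lenP _; rewrite LG ler_wpM2r ?(ltW Ggt0) // ler_nat.
  by rewrite /c1 leqW // leq_pmull // expn_gt0 muln_gt0 n0.
have LP0 : 0 < LP := lt_le_trans ltr01 LP1.
have e0 : (0 < e)%N by rewrite /e -ltnS prednK // ltnW.
have en : (e <= n)%N by rewrite /e -ltnS prednK // ltnW.
have T1 : LQ ^+ e * LP ^+ m <= LQ ^+ E * LQ.
  rewrite -exprSr (_ : E.+1 = n + m)%N; last by rewrite /E prednK // addn_gt0 n0.
  rewrite exprD; apply: ler_pM; rewrite ?exprn_ge0 ?(ltW LQ0) ?(ltW LP0) //.
    by rewrite ler_weXn2l.
  by rewrite lerXn2r ?nnegrE // ltW.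
have T2 : LQ ^+ e * LP ^+ m <= LQ ^+ E * LP.
  have -> : LP ^+ m = LP ^+ m.-1 * LP by rewrite -exprSr prednK.
  rewrite mulrA ler_wpM2r ?(ltW LP0) //.
  apply: le_trans (_ : LQ ^+ n * LQ ^+ m.-1 <= _); last first.
    by rewrite -exprD /E -subn1 -subn1 addnBA.
  apply: ler_pM; rewrite ?exprn_ge0 ?(ltW LQ0) ?(ltW LP0) //.
    by rewrite ler_weXn2l.
  by rewrite lerXn2r ?nnegrE // ltW.
have {}T1 : `|ev Q| / LQ * (LQ ^+ e * LP ^+ m) <= `|ev Q| * LQ ^+ E.
  by rewrite mulrAC ler_pdivrMr // -mulrA ler_wpM2l.
have {}T2 : `|ev P| / LP * (LQ ^+ e * LP ^+ m) <= `|ev P| * LQ ^+ E.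
  by rewrite mulrAC ler_pdivrMr // -mulrA ler_wpM2l.
have T3 : `|ev P| * LQ ^+ E <= (2 * K)^-1.
  apply: le_trans (ler_wpM2r (exprn_ge0 _ (ltW LQ0)) smallP) _.
  have -> : G `^ (- omega) * LQ ^+ E = c1%:R ^+ E / G `^ (omega - E%:R).
    rewrite eG Gsplit LG exprMn invfM -mulrA [X in _ * X]mulrCA mulVf ?(gt_eqF GE) //.
    by rewrite mulr1 mulrC.
  rewrite ler_pdivrMr ?powR_gt0 // mulrC ler_pdivlMr ?mulr_gt0 // mulrC.
  exact: ltW (big _ M1G).
rewrite mulrDl => le1.
have {}le1 : 1 <= K * (`|ev Q| * LQ ^+ E + (2 * K)^-1).
  apply: le_trans le1 _; rewrite ler_wpM2l ?(ltW K0) // lerD //.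
  exact: le_trans T2 T3.
rewrite -(ler_pM2l K0).
have KK : K * (2 * K)^-1 = 2^-1 by rewrite invfM mulrCA divff ?mulr1 // gt_eqF.
by rewrite mulrDr KK in le1; rewrite KK; lra.
Qed.

End Bounds.

(** * The exponent count *)

Lemma prod_zlength_le n (s : seq {poly int}) :
  \prod_(Q <- s) Q != 0 -> (size (\prod_(Q <- s) Q)%R <= n.+1)%N ->
  (\prod_(Q <- s) zlength Q <=
     ((2 * n) ^ n) ^ size s * zlength (\prod_(Q <- s) Q)%R)%N.
Proof.
elim: s => [|Q s IHs].
  by rewrite !big_nil /= expn0 mul1n zlength1.
rewrite !big_cons /= mulf_eq0 negb_or => /andP[Q0 s0] sz.
have szs : (size (\prod_(j <- s) j)%R <= n.+1)%N.
  apply: leq_trans sz; apply: zsize_dvd; first exact: mulf_neq0.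
  exact: dvdp_mulIr.
apply: leq_trans (leq_mul (leqnn _) (IHs s0 szs)) _.
rewrite mulnCA expnSr -mulnA leq_mul2l; apply/orP; right.
by apply: zlengthM_ge => //; exact: mulf_neq0.
Qed.

Lemma zlength_prod_le (s : seq {poly int}) :
  (zlength (\prod_(Q <- s) Q)%R <= \prod_(Q <- s) zlength Q)%N.
Proof.
elim: s => [|Q s IHs]; first by rewrite !big_nil zlength1.
by rewrite !big_cons (leq_trans (zlengthM _ _)) // leq_mul2l IHs orbT.
Qed.

Lemma size_prod_uniform m (s : seq {poly int}) :
  (forall Q, Q \in s -> size Q = m.+1) ->
  size (\prod_(Q <- s) Q) = (m * size s).+1.
Proof.
elim: s => [|Q s IHs] szs; first by rewrite big_nil size_poly1 muln0.
have szQ : size Q = m.+1 by apply: szs; rewrite mem_head.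
have {}IHs := IHs (fun M Ms => szs M (mem_behead (s := Q :: s) Ms)).
rewrite big_cons zsize_mul ?szQ ?IHs /=; last 2 first.
- by rewrite -size_poly_gt0 szQ.
- by rewrite -size_poly_gt0 IHs.
by rewrite addnS mulnS.
Qed.

Lemma norm_prod_lower_bound (R : realType) (xi c : R) (E : nat) (s : seq {poly int}) :
  0 <= c -> (forall Q, Q \in s -> c <= `|zeval xi Q| * (zlength Q)%:R ^+ E) ->
  c ^+ size s <= `|zeval xi (\prod_(Q <- s) Q)| * (\prod_(Q <- s) zlength Q)%N%:R ^+ E.
Proof.
move=> c0; elim: s => [|Q s IHs] le_c.
  by rewrite !big_nil /= expr0 expr1n /zeval rmorph1 hornerC normr1 mulr1.
rewrite !big_cons /= zevalM normrM natrM exprMn exprS mulrACA.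
apply: ler_pM; rewrite ?exprn_ge0 // ?le_c ?mem_head //.
by apply: IHs => M Ms; rewrite le_c // inE Ms orbT.
Qed.

Section Bookkeeping.
Variable R : realFieldType.
Implicit Types (a X LA LS : R).

(** With [a = |A(xi)|] and [sS = |S(xi)|], for a polynomial [P = A S] with
    [|P(xi)| X^(D + r) << v e]: the lower bound for [sS] is traded for an upper
    bound for [a], and the power of [LS] in it for one of [X / LA]. *)
Lemma nonrepeated_bound (D r dS : nat) a X LA LS sS v e K C1 c2 :
  0 <= a -> 0 < sS -> 0 <= e -> 1 <= X -> 0 <= LA -> 1 <= LS -> 0 <= K -> 0 <= C1 ->
  (dS <= D)%N -> v <= K * (sS * LS ^+ dS) -> LA * LS <= c2 * X ->
  a * sS * X ^+ (D + r) <= C1 * (v * e) ->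
  a * LA ^+ D * X ^+ r <= C1 * K * c2 ^+ D * e.
Proof.
move=> a0 sS0 e0 X1 LA0 LS1 K0 C10 dD le_v le_L le_P.
have X0 : 0 < X := lt_le_trans ltr01 X1.
have LS0 : 0 <= LS := le_trans ler01 LS1.
have H1 : a * X ^+ (D + r) <= C1 * K * e * LS ^+ D.
  rewrite -(ler_pM2r sS0) mulrAC; apply: le_trans le_P _.
  rewrite -!mulrA ler_wpM2l //.
  have -> : K * (e * (LS ^+ D * sS)) = (K * (sS * LS ^+ D)) * e by ring.
  rewrite ler_wpM2r //; apply: le_trans le_v _.
  by rewrite ler_wpM2l // ler_wpM2l ?(ltW sS0) // ler_weXn2l.
rewrite -(ler_pM2r (exprn_gt0 D X0)).
have -> : a * LA ^+ D * X ^+ r * X ^+ D = a * X ^+ (D + r) * LA ^+ D.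
  by rewrite exprD; ring.
apply: le_trans (ler_wpM2r (exprn_ge0 D LA0) H1) _.
have -> : C1 * K * c2 ^+ D * e * X ^+ D = C1 * K * e * (c2 * X) ^+ D.
  by rewrite exprMn; ring.
have -> : C1 * K * e * LS ^+ D * LA ^+ D = C1 * K * e * (LA * LS) ^+ D.
  by rewrite exprMn; ring.
have CKe0 : 0 <= C1 * K * e by rewrite !mulr_ge0.
have LALS0 : 0 <= LA * LS by rewrite mulr_ge0.
by rewrite ler_wpM2l // lerXn2r ?nnegrE // (le_trans LALS0).
Qed.

(** The power of [X] in the bound for [a] is at least a power of [LA], since the
    [k] factors of [A] divide the cofactor of [A]. *)
Lemma repeated_bound (D m k : nat) a X LA b B :
  0 <= a -> 0 <= LA -> 0 <= X -> 0 <= b ->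
  LA ^+ k.+1 <= (b * X) ^+ k -> a * LA ^+ D * X ^+ (m * k) <= B ->
  a * LA ^+ (D + m * k + m) <= b ^+ (m * k) * B.
Proof.
move=> a0 LA0 X0 b0 le_LA le_B.
have -> : LA ^+ (D + m * k + m) = LA ^+ D * (LA ^+ k.+1) ^+ m.
  by rewrite -exprM -exprD -addnA mulSn addnC [(m * k)%N]mulnC; congr (_ ^+ _); lia.
apply: le_trans (_ : a * LA ^+ D * (b * X) ^+ (m * k) <= _).
  rewrite mulrA ler_wpM2l ?mulr_ge0 ?exprn_ge0 // [(m * k)%N]mulnC exprM.
  by rewrite lerXn2r ?nnegrE ?exprn_ge0 ?mulr_ge0.
by rewrite exprMn mulrCA ler_wpM2l ?exprn_ge0.
Qed.

End Bookkeeping.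

Lemma leq_prod_exp (T : eqType) (s : seq T) (F : T -> nat) (b : nat) :
  (forall x, x \in s -> F x <= b)%N -> (\prod_(x <- s) F x <= b ^ size s)%N.
Proof.
elim: s => [|x s IHs] leF; first by rewrite big_nil.
rewrite big_cons /= expnS leq_mul ?leF ?mem_head //.
by apply: IHs => y ys; rewrite leF // inE ys orbT.
Qed.

(** The argument described at the top, with explicit constants: [X] is taken so
    large that the gain [X^-eta] outweighs all of them. *)
Lemma no_exponent_gap (R : realType) (n : nat) (xi omega s : R) :
  (1 <= n <= 5)%N -> transcendental xi -> s + (n%:R - 1) < omega ->
  (exists M : R, forall X, M < X ->
    exists2 P, polys_upto n X P & `|zeval xi P| <= X `^ (- omega)) ->
  ~ (forall M : R, exists2 X, M < X &
    forall alpha, algs_upto n X alpha -> X `^ (- s) <= alg_dist xi alpha).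
Proof.
move=> /andP[n1 n5] tr gap approx freq.
have s1 := exponent_ge1 n1 freq.
have s0 : 0 <= s := le_trans ler01 s1.
have n1R : 1 <= n%:R :> R by rewrite ler1n.
have omega_n : n%:R < omega by lra.
have omega0 : 0 < omega := le_lt_trans (le_trans ler01 n1R) omega_n.
have [c1 c10 low1] : exists2 c : R, 0 < c & forall Q : {poly int},
    irreducible_poly Q -> zcontents Q = 1 -> size Q = 2%N ->
    c <= `|zeval xi Q| * (zlength Q)%:R ^+ (n + 1).-1.
  by apply: irreducible_lower_bound tr _ _ approx; rewrite ?n1 // natrD; lra.
have [c2 c20 low2] : exists2 c : R, 0 < c &
    (2 <= n)%N -> (n + 2)%:R - 1 < omega -> forall Q : {poly int},
    irreducible_poly Q -> zcontents Q = 1 -> size Q = 3%N ->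
    c <= `|zeval xi Q| * (zlength Q)%:R ^+ (n + 2).-1.
  have [n2|n2] := ltnP 1 n; last by exists 1.
  have [lt_om|le_om] := ltP ((n + 2)%:R - 1) omega;
    last by exists 1 => // _; rewrite ltNge le_om.
  have [|c c0 low] := irreducible_lower_bound tr (_ : (0 < 2 <= n)%N) lt_om approx.
    by rewrite n2.
  by exists c.
have [K K0 sqf] := squarefree_lower_bound xi n.
pose c := Num.min (Num.min c1 c2) 1.
have c0 : 0 < c by rewrite !lt_min c10 c20 ltr01.
have cle1 : c <= 1 by rewrite ge_min lexx orbT.
have cc1 : c <= c1 by rewrite !ge_min lexx.
have cc2 : c <= c2 by rewrite !ge_min lexx orbT.
pose eta := omega - s - (n%:R - 1).
have eta0 : 0 < eta by rewrite /eta; lra.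
have etaE : - omega + n.-1%:R = - s - eta.
  by rewrite /eta -subn1 natrB //; ring.
(* g is the loss in passing from a polynomial to its factors, and X / b is the
   height allowed for P. *)
pose g := ((2 * n) ^ n)%N; pose b := (g * n.+1)%N.
have g0 : (0 < g)%N by rewrite expn_gt0 muln_gt0 n1.
have b0 : (0 < b)%N by rewrite muln_gt0 g0.
have b0R : 0 < b%:R :> R by rewrite ltr0n.
have gR1 : 1 <= g%:R :> R by rewrite ler1n.
have gR0 : 0 <= g%:R :> R by rewrite ler0n.
pose C1 := b%:R `^ omega.
have C10 : 0 < C1 by rewrite powR_gt0.
(* A bound for the exponent k * E + m * k of g that the count produces. *)
pose T := (n * n.+1 + 2 * n)%N.
have [M1 M11 big] := powR_unbounded (g%:R ^+ T * (C1 * K) / c ^+ n + K * (C1 * K)) eta0.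
have [M0 approxM] := approx.
have [X ltX far] := freq (Num.max M1 (b%:R * Num.max M0 1)).
move: ltX; rewrite gt_max => /andP[ltX1 ltX0].
have X1 : 1 < X := le_lt_trans M11 ltX1.
have Xgt0 : 0 < X := lt_trans ltr01 X1.
have [Y XY] : exists Y, X = b%:R * Y.
  by exists (X / b%:R); rewrite mulrC divfK // gt_eqF.
have : Num.max M0 1 < Y by move: ltX0; rewrite XY ltr_pM2l.
rewrite gt_max => /andP[M0Y Y1]; have Y0 : 0 < Y := lt_trans ltr01 Y1.
have [P [P0 szP htP] smallP] := approxM Y M0Y.
have Yom : 0 < Y `^ omega by rewrite powR_gt0.
have smallP1 : `|zeval xi P| < 1.
  apply: le_lt_trans smallP _; rewrite powRN invf_lt1 //.
  rewrite (_ : 1 = 1 `^ omega); last by rewrite powR1.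
  by apply: gt0_ltr_powR => //; rewrite nnegrE // ltW.
have szP1 := nonconstant_of_small P0 smallP1.
have lenP : g%:R * (zlength P)%:R <= X.
  apply: le_trans (_ : g%:R * (n.+1 * poly_height P)%N%:R <= _).
    by rewrite ler_wpM2l // ler_nat zlength_le_poly_height.
  by rewrite XY /b !natrM -!mulrA !ler_wpM2l.
pose v := X `^ (- s); pose e := X `^ (- eta).
have v0 : 0 < v by rewrite powR_gt0.
have e0 : 0 < e by rewrite powR_gt0.
have v1 : v <= 1 by rewrite /v -(powRr0 X) ler_powR ?oppr_le0 // ltW.
have sep alpha : root (map_poly intr P) alpha -> v <= alg_dist xi alpha.
  move=> ra; apply: far; have [deg_a ht_a] := alg_height_degree_le P0 szP ra.
  split=> //; first exact: algebraic_root P0 ra.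
  by apply: le_trans lenP; rewrite -natrM ler_nat.
have valP : `|zeval xi P| * X ^+ n.-1 <= C1 * (v * e).
  apply: le_trans (ler_wpM2r (exprn_ge0 _ (ltW Xgt0)) smallP) _.
  have -> : Y `^ (- omega) = C1 * X `^ (- omega).
    have bC : b%:R `^ (- omega) * C1 = 1 by rewrite /C1 powRN mulVf // gt_eqF.
    by rewrite XY powRM ?(ltW b0R) ?(ltW Y0) // mulrCA mulrA bC mul1r.
  rewrite -mulrA ler_wpM2l ?(ltW C10) // -powR_mulrn ?(ltW Xgt0) //.
  by rewrite /v /e -!powRD ?(gt_eqF Xgt0) ?implybT // etaE.
have szP6 : (size P <= 6)%N := leq_trans szP (leq_ltn_trans n5 (ltnSn _)).
have [m [rs [S [DP coS rsS mrs]]]] := squarefree_part P0 szP6.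
set A := \prod_(Q <- rs) Q in DP.
have A0 : A != 0 by apply: contraNneq P0 => A0; rewrite DP A0 mul0r.
have S0 : S != 0 by apply: contraNneq P0 => S0; rewrite DP S0 mulr0.
set k := size rs in mrs.
have szA : size A = (m * k).+1.
  by apply: size_prod_uniform => Q /rsS[].
have szPE : size P = (m * k + size S)%N by rewrite DP zsize_mul // szA.
have rootS Q alpha : Q %| P -> root (map_poly intr Q) alpha -> v <= alg_dist xi alpha.
  move=> QP rQ; apply: sep; have [B ->] := dvdpP_int QP.
  rewrite rmorphM rootM; apply/orP; left; move: rQ.
  have Q0 : Q != 0 by apply: contraNneq P0 => Q0; move: QP; rewrite Q0 dvd0p.
  by rewrite [Q in map_poly _ Q]zpolyEprim map_polyZ rootZ //= intr_eq0 zcontents_eq0.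
have m0 : (0 < m)%N by case: mrs => [->|[->]].
have szS1 : (1 < size S)%N.
  case: (posnP k) => [k0|k0]; first by move: szPE; rewrite k0 muln0 add0n => <-.
  have [Q Qrs] : exists Q, Q \in rs.
    by move: k0; rewrite /k; case: (rs) => // Q t _; exists Q; rewrite mem_head.
  have [irrQ _ _ QS] := rsS Q Qrs.
  by apply: leq_trans (zsize_dvd S0 QS); exact: zsize_irreducible.
have szSn : (size S <= n.+1)%N by apply: leq_trans szP; rewrite szPE leq_addl.
set LA : R := (zlength A)%:R; set LS : R := (zlength S)%:R.
have LA1 : 1 <= LA by rewrite ler1n zlength_gt0.
have LS1 : 1 <= LS by rewrite ler1n zlength_gt0.
have LA0 : 0 <= LA := le_trans ler01 LA1.
have LS0 : 0 <= LS := le_trans ler01 LS1.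
have LASX : LA * LS <= X.
  apply: le_trans lenP; rewrite -!natrM ler_nat DP.
  by apply: zlengthM_ge; rewrite -DP.
set a := `|zeval xi A|; have a0 : 0 <= a := normr_ge0 _.
set sS := `|zeval xi S|.
have sS0 : 0 < sS by rewrite normr_gt0 zeval_neq0.
have valP' : `|zeval xi P| = a * sS by rewrite DP zevalM normrM.
have vS : v <= K * (sS * LS ^+ (size S - 2)).
  apply: sqf; rewrite ?szS1 ?v0 //.
  by move=> alpha; apply: rootS; rewrite DP dvdp_mulIr.
pose D := (n.-1 - m * k)%N.
have mkn : (m * k <= n.-1)%N.
  have : (m * k + 2 <= n.+1)%N by apply: leq_trans szP; rewrite szPE leq_add2l.
  by rewrite addn2 ltnS => lt_mk; rewrite -ltnS prednK.
have ED : n.-1 = (D + m * k)%N by rewrite /D subnK.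
have dD : (size S - 2 <= D)%N.
  rewrite /D leq_subRL // addnBA // leq_subLR -szPE.
  by rewrite addSn add1n prednK.
have base : a * LA ^+ D * X ^+ (m * k) <= C1 * K * e.
  have := @nonrepeated_bound R D (m * k) (size S - 2) a X LA LS sS v e K C1 1
    a0 sS0 (ltW e0) (ltW X1) LA0 LS1 (ltW K0) (ltW C10) dD vS.
  by rewrite mul1r expr1n mulr1 -ED -valP'; apply.
have LAk : LA ^+ k.+1 <= (g%:R * X) ^+ k.
  have le_LA : LA <= (g%:R * LS) ^+ k.
    rewrite /LA /LS -natrM -natrX ler_nat; apply: leq_trans (zlength_prod_le _) _.
    apply: leq_prod_exp => Q /rsS[_ cQ _ QS].
    exact: zlength_dvd.
  rewrite exprSr; apply: le_trans (ler_wpM2l (exprn_ge0 _ LA0) le_LA) _.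
  rewrite -exprMn lerXn2r ?nnegrE ?mulr_ge0 ?(ltW Xgt0) //.
  by rewrite mulrCA ler_wpM2l.
have rep := repeated_bound a0 LA0 (ltW Xgt0) gR0 LAk base.
have eV : e = (X `^ eta)^-1 by rewrite /e powRN.
have Xeta : 0 < X `^ eta by rewrite powR_gt0.
have bigX := big X ltX1.
have CK0 : 0 <= C1 * K by rewrite mulr_ge0 // ltW.
(* A repeated quadratic factor satisfies vA, which forces s > 2. *)
have omega_gt : (n + m)%:R - 1 < omega.
  case: mrs => [->|[m2 k1]]; first by rewrite natrD addrK.
  rewrite m2 ltNge; apply/negP => le_om.
  have [Q rsE] : exists Q, rs = [:: Q].
    by move: k1; rewrite /k; case: (rs) => // Q [|//] _; exists Q.
  have [irrQ _ szQ QS] : [/\ irreducible_poly Q, zcontents Q = 1, size Q = m.+1 & Q %| S].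
    by apply: rsS; rewrite rsE mem_head.
  have AQ : A = Q by rewrite /A rsE big_seq1.
  have D1 : (1 <= D)%N.
    by apply: leq_trans dD; rewrite subn_gt0 (leq_trans _ (zsize_dvd S0 QS)) // szQ m2.
  have vA : v <= K * (a * LA).
    rewrite -[LA]expr1 /a /LA AQ (_ : 1 = size Q - 2)%N; last by rewrite szQ m2.
    apply: sqf; rewrite ?v0 // ?szQ ?m2.
    - apply: irreducible_coprimep => //; apply/negP => /dvdp_leq.
      rewrite -size_poly_gt0 size_deriv szQ m2 => /(_ isT).
      by rewrite ltnn.
    - by rewrite /= -m2 -szQ (leq_trans _ szSn) // zsize_dvd.
    - by move=> alpha; apply: rootS; rewrite DP AQ dvdp_mulIl.
  have vX2 : 1 <= v * X ^+ 2.
    rewrite -powR_mulrn ?(ltW Xgt0) // /v -powRD ?(gt_eqF Xgt0) ?implybT //.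
    rewrite -[leLHS](powRr0 X) ler_powR ?(ltW X1) //.
    by move: le_om gap; rewrite natrD; clear; lra.
  have le1 : 1 <= K * (C1 * K) * e.
    apply: le_trans vX2 _; rewrite -mulrA.
    apply: le_trans (_ : K * (a * LA ^+ D * X ^+ (m * k)) <= _).
      rewrite m2 k1 muln1 [leRHS]mulrA ler_wpM2r ?exprn_ge0 ?(ltW Xgt0) //.
      apply: le_trans vA _; rewrite ler_wpM2l ?(ltW K0) // ler_wpM2l //.
      by rewrite -[leLHS]expr1 ler_weXn2l.
    by rewrite ler_wpM2l ?(ltW K0).
  move: le1; rewrite eV leNgt => /negP; apply.
  rewrite ltr_pdivrMr // mul1r; apply: le_lt_trans bigX.
  by rewrite lerDr divr_ge0 ?exprn_ge0 ?mulr_ge0 ?exprn_ge0 // ltW.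
have low Q : Q \in rs -> c <= `|zeval xi Q| * (zlength Q)%:R ^+ (n + m).-1.
  move=> Qrs; have [irrQ cQ szQ QS] := rsS Q Qrs.
  case: mrs => [m1|[m2 k1]].
    by rewrite m1 in szQ *; apply: le_trans cc1 _; apply: low1.
  rewrite m2 in szQ omega_gt *; apply: le_trans cc2 _; apply: low2 => //.
  by rewrite -ltnS; apply: leq_trans szSn; rewrite -szQ; apply: zsize_dvd.
have lowA := norm_prod_lower_bound (ltW c0) low.
set E := (n + m).-1 in lowA.
have EE : (D + m * k + m = E)%N.
  by rewrite -ED /E -!subn1 addnBAC.
rewrite EE in rep.
have prodA : (\prod_(Q <- rs) zlength Q)%N%:R <= g%:R ^+ k * LA.
  rewrite -natrX -natrM ler_nat; apply: prod_zlength_le => //.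
  by apply: leq_trans szP; apply: zsize_dvd; rewrite // DP dvdp_mulIl.
have : c ^+ n <= g%:R ^+ T * (C1 * K) * e.
  have m2 : (m <= 2)%N by case: mrs => [->|[->]].
  have kn : (k <= n)%N.
    by apply: leq_trans (leq_pred n); apply: leq_trans mkn; rewrite leq_pmull.
  apply: le_trans (_ : c ^+ k <= _); first by rewrite ler_wiXn2l // ltW.
  apply: le_trans lowA _; rewrite -/A -/a.
  apply: le_trans (_ : a * (g%:R ^+ k * LA) ^+ E <= _).
    by rewrite ler_wpM2l // lerXn2r ?nnegrE ?mulr_ge0 ?exprn_ge0.
  rewrite exprMn mulrCA -exprM.
  apply: le_trans (ler_wpM2l (exprn_ge0 _ gR0) rep) _.
  rewrite [leLHS]mulrA -exprD -[leRHS]mulrA ler_wpM2r //.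
    by rewrite mulr_ge0 // ltW.
  rewrite ler_weXn2l // /T leq_add //.
    rewrite leq_mul // /E -ltnS prednK ?addn_gt0 ?n1 //.
    by rewrite -addn2 leq_add2l.
  apply: leq_trans mkn _; apply: leq_trans (leq_pred _) _.
  by rewrite leq_pmull.
rewrite leNgt => /negP; apply.
rewrite eV ltr_pdivrMr // [ltRHS]mulrC -ltr_pdivrMr ?exprn_gt0 //.
apply: le_lt_trans bigX; rewrite lerDl mulr_ge0 //; exact: ltW.
Qed.

Theorem theorem2p1 (R : realType) (n : nat) (xi : R)
    (hn : (1 <= n <= 5)%N) (hxi : transcendental xi) :
  (w_hat n xi - wstar_hat n xi <= (n%:R - 1)%:E)%E.
Proof.
have freq s : (wstar_hat n xi < s%:E)%E -> forall N, exists2 X, N < X &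
    forall alpha, algs_upto n X alpha -> X `^ (- s) <= alg_dist xi alpha.
  move=> /limf_einf_lt lt_s N; have [X ltX lt_sX] := lt_s (Num.max N 1).
  move: ltX; rewrite gt_max => /andP[NX X1].
  exists X => //; exact: wstar_lt_alg_dist.
have ge1 s : (wstar_hat n xi < s%:E)%E -> 1 <= s.
  by move=> /freq; apply: exponent_ge1; case/andP: hn.
have n1 : 1 <= n%:R :> R by rewrite ler1n; case/andP: hn.
have main omega s : s + (n%:R - 1) < omega -> (omega%:E < w_hat n xi)%E ->
    ~ (wstar_hat n xi < s%:E)%E.
  move=> gap /limf_einf_gt[M approx] lt_s; have s1 := ge1 _ lt_s.
  apply: (no_exponent_gap hn hxi gap) (freq _ lt_s).
  exists (Num.max M 1) => X; rewrite gt_max => /andP[MX X1].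
  by apply: w_gt_best => //; [lra|exact: approx].
rewrite leNgt; apply/negP.
case: (wstar_hat n xi) ge1 main => [v| |] ge1 main.
- case: (w_hat n xi) main => [r| |] main //=.
  + rewrite -EFinB lte_fin => gap.
    pose d := (r - v - (n%:R - 1)) / 3; have d0 : 0 < d by rewrite divr_gt0 // subr_gt0.
    by apply: (main (r - d) (v + d)); rewrite ?lte_fin; rewrite /d in d0 *; lra.
  + by move=> _; apply: (main (v + 1 + n%:R) (v + 1)); rewrite ?lte_fin ?ltry //; lra.
(* Here wstar_hat is +oo, and even +oo - +oo is -oo. *)
- by case: (w_hat n xi) => [r| |] //=.
- by have := ge1 0 (ltNyr _); rewrite ler10.
Qed.
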